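(* Let $P,Q$ be rational functions with complex coefficients such that $\mathcal C(P)\cap\mathcal C(Q)$ contains (exactly) two elements. Then the curve $h_{P,Q}(x,y)=0$ is reducible if and only if there exist rational functions $R,S$ and a Möbius transformation $\mu$ such that $$P=\mu\circ z^d\circ R,\qquad Q=\mu\circ z^d\circ S$$ for some integer $d>1$.
   Context: A non-constant rational function $F$ is regarded as a holomorphic map $\mathbb{CP}^1\to\mathbb{CP}^1$ of degree $\deg F$. A point $s\in\mathbb{CP}^1$ is called a critical value of $F$ if $F^{-1}\{s\}$ contains fewer than $\deg F$ points; $\mathcal C(F)$ is the set of all critical values of $F$. Write $P=P_1/P_2$, $Q=Q_1/Q_2$, where $P_1,P_2$ and $Q_1,Q_2$ are pairs of polynomials without common roots. The curve $h_{P,Q}(x,y)=0$ is the affine algebraic curve $$h_{P,Q}(x,y):\ P_1(x)Q_2(y)-P_2(x)Q_1(y)=0,$$ and it is called irreducible (reducible) if the polynomial on the left-hand side is irreducible (reducible) in $\mathbb C[x,y]$. The symbol $\circ$ denotes composition, and $z^d$ denotes the map $z\mapsto z^d$. *)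

(* Defs.v *)
From mathcomp Require Import all_boot all_order all_algebra.
From mathcomp Require Import complex.
From mathcomp Require Import boolp classical_sets functions cardinality reals.

Set Implicit Arguments.
Unset Strict Implicit.
Unset Printing Implicit Defensive.

Import GRing.Theory.

Local Open Scope ring_scope.
Local Open Scope quotient_scope.
Local Open Scope classical_set_scope.
Local Open Scope card_scope.

Notation ratfun K := {fraction {poly K}}.

Notation "x %:F" := (tofrac x) : ring_scope.

Section RationalFunctions.
Variable K : fieldType.
Implicit Types (F : ratfun K) (p q : {poly K}).

(* [Some z] is the finite point z, [None] is the point at infinity. *)
Definition projline := option K.

(* The point with homogeneous coordinates [a : b]; only meaningful when
   (a, b) is not (0, 0). *)
Definition hpoint (a b : K) : projline :=
  if b == 0 then None else Some (a / b).

(* The representative chosen by [repr] need not be in lowest terms. *)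
Definition ratnum F : {poly K} :=
  (repr F : {ratio {poly K}}).1 %/
    gcdp (repr F : {ratio {poly K}}).1 (repr F : {ratio {poly K}}).2.

Definition ratden F : {poly K} :=
  (repr F : {ratio {poly K}}).2 %/
    gcdp (repr F : {ratio {poly K}}).1 (repr F : {ratio {poly K}}).2.

Lemma ratden_neq0 F : ratden F != 0.
Proof.
have d0 := denom_ratioP (repr F : {ratio {poly K}}).
by rewrite /ratden dvdp_div_eq0 ?dvdp_gcdr.
Qed.

Lemma coprimep_ratnum_ratden F : coprimep (ratnum F) (ratden F).
Proof.
have d0 := denom_ratioP (repr F : {ratio {poly K}}).
by apply: coprimep_div_gcd; rewrite d0 orbT.
Qed.

(* deg F = max (deg num, deg den); recall that [size p] is deg p + 1. *)
Definition ratdeg F : nat := (maxn (size (ratnum F)) (size (ratden F))).-1.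

(* At infinity the value is read off from the coefficients of degree deg F,
   i.e. from the homogenizations of numerator and denominator at [1 : 0]. *)
Definition ratmap F (x : projline) : projline :=
  match x with
  | Some z => hpoint (ratnum F).[z] (ratden F).[z]
  | None => hpoint (ratnum F)`_(ratdeg F) (ratden F)`_(ratdeg F)
  end.

(* For constant F one has ratdeg F = 0, so there are no critical values. *)
Definition critical_values F : set projline :=
  [set s | ~ (`I_(ratdeg F) #<= ratmap F @^-1` [set s])].

Definition is_mobius (mu : projline -> projline) : Prop :=
  exists a b c d : K, a * d - b * c != 0 /\
    forall x, mu x = match x with
                     | Some z => hpoint (a * z + b) (c * z + d)
                     | None => hpoint a c
                     end.

(* Fixes infinity, hence agrees with the map z^d for d > 0 only. *)
Definition zpow (d : nat) : projline -> projline := omap (fun z => z ^+ d).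

(* K[x, y] is {poly {poly K}}: x is the outer variable 'X and y is the inner
   one, so [p ^:P] is p(x) and [p%:P] is p(y). *)
Definition hcurve (P1 P2 Q1 Q2 : {poly K}) : {poly {poly K}} :=
  P1 ^:P * Q2%:P - P2 ^:P * Q1%:P.

Lemma ratfunE F : F = (ratnum F)%:F / (ratden F)%:F.
Proof.
have d0 : (repr F : {ratio {poly K}}).2 != 0 := denom_ratioP _.
set n := (repr F : {ratio {poly K}}).1 in d0 *.
set d := (repr F : {ratio {poly K}}).2 in d0 *.
have FE : F * d%:F = n%:F.
  rewrite -{1}(reprK F); unlock FracField.tofrac; rewrite !piE.
  apply/eqmodP/eqP; rewrite /= /FracField.mulf.
  by rewrite !numden_Ratio ?mulf_neq0 ?oner_eq0 // !mulr1 mulrC.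
have nE : n = ratnum F * gcdp n d by rewrite divpK ?dvdp_gcdl.
have dE : d = ratden F * gcdp n d by rewrite divpK ?dvdp_gcdr.
have g0 : (gcdp n d)%:F != 0 by rewrite tofrac_eq0 gcdp_eq0 negb_and d0 orbT.
apply: (canRL (mulfK _)); first by rewrite tofrac_eq0 ratden_neq0.
by apply: (mulIf g0); rewrite -mulrA -!tofracM -dE -nE.
Qed.

Lemma ratfun_coprimeE p q : q != 0 -> coprimep p q ->
  exists2 c : K, c != 0 & p = c *: ratnum (p%:F / q%:F) /\
                          q = c *: ratden (p%:F / q%:F).
Proof.
move=> q0 pq; move FE : (p%:F / q%:F) => F.
have cF := coprimep_ratnum_ratden F; have d0 := ratden_neq0 F.
have E : p * ratden F = ratnum F * q.
  apply/eqP; rewrite -tofrac_eq !tofracM; apply/eqP.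
  have q0' : q%:F != 0 by rewrite tofrac_eq0.
  have d0' : (ratden F)%:F != 0 by rewrite tofrac_eq0.
  have Fp : F * q%:F = p%:F by rewrite -FE (divfK q0').
  have Fn : F * (ratden F)%:F = (ratnum F)%:F.
    by rewrite [X in X * _]ratfunE (divfK d0').
  by rewrite -Fp -Fn mulrAC.
have dq : ratden F %| q.
  by rewrite -(@Gauss_dvdpr _ _ (ratnum F)) -?E ?dvdp_mull // coprimep_sym.
have qd : q %| ratden F.
  by rewrite -(@Gauss_dvdpr _ _ p) ?E ?dvdp_mull // coprimep_sym.
have /eqpf_eq[c c0 qE] : q %= ratden F by rewrite /eqp qd dq.
exists c => //; split=> //; apply: (mulIf d0).
by rewrite E qE -scalerAl -scalerAr.
Qed.

Lemma ratdegE p q : q != 0 -> coprimep p q ->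
  ratdeg (p%:F / q%:F) = (maxn (size p) (size q)).-1.
Proof.
move=> q0 pq; have [c c0 [pE qE]] := ratfun_coprimeE q0 pq.
rewrite /ratdeg; move: pE qE; move: (ratnum _) (ratden _) => a b -> ->.
by rewrite !size_scale.
Qed.

Lemma ratmapE p q z : q != 0 -> coprimep p q ->
  ratmap (p%:F / q%:F) (Some z) = hpoint p.[z] q.[z].
Proof.
move=> q0 pq; have [c c0 [pE qE]] := ratfun_coprimeE q0 pq.
rewrite /ratmap; move: pE qE; move: (ratnum _) (ratden _) => a b -> ->.
rewrite /hpoint !hornerZ mulf_eq0 (negPf c0) /=.
by case: ifP => // _; rewrite -mulf_div divff ?mul1r.
Qed.

Lemma ratmap_inftyE p q (n := (maxn (size p) (size q)).-1) :
  q != 0 -> coprimep p q -> ratmap (p%:F / q%:F) None = hpoint p`_n q`_n.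
Proof.
move=> q0 pq; have [c c0 [pE qE]] := ratfun_coprimeE q0 pq.
rewrite /ratmap ratdegE // -/n; move: n pE qE.
move: (ratnum _) (ratden _) => a b n -> ->.
rewrite /hpoint !coefZ mulf_eq0 (negPf c0) /=.
by case: ifP => // _; rewrite -mulf_div divff ?mul1r.
Qed.

End RationalFunctions.

(* [irreducible_poly] is not the right notion for {poly {poly K}}: it ignores
   non-unit factors of degree 0 in the outer variable. *)
Definition reducible (A : unitRingType) (u : A) : Prop :=
  exists v w : A,
    [/\ v \isn't a GRing.unit, w \isn't a GRing.unit & u = v * w].

(* Main.v *)
(** Move the two common critical values to [0] and infinity, and a point of each
    source line lying over infinity to infinity. Write [t = P(x)] and consider a
    monic factor [F] in [y], over [K(x)], of [Q1(y) - t Q2(y)]. The derivation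
    [theta = t d/dt] of [K(x)] sends the coefficients of [F] to functions whose
    poles are no worse: over [0] and infinity it is logarithmic, and at a point
    over [s <> 0] either [P] is unramified there, or [s] is not a critical value
    of [Q] and the vector field [t d/dt] lifts regularly to the [y]-line. Hence
    the [theta]-orbit of a coefficient spans a finite-dimensional space, on which
    [theta] is diagonalizable, so each coefficient is a sum of eigenfunctions.
    Every eigenfunction is a constant times a power of one [u] with
    [u ^ m = P]. Therefore the curve [u ^ m = Q(y)] is reducible, and taking the norm
    of [u] from a factor gives [Q = S ^ d] with [d > 1] dividing [m], whence
    [P = (u ^ (m / d)) ^ d]. *)
Require Import Defs.
From HB Require Import structures.
From mathcomp Require Import all_boot all_order all_algebra all_field.
From mathcomp Require Import complex ring.
From mathcomp Require Import boolp classical_sets functions cardinality reals.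

Set Implicit Arguments.
Unset Strict Implicit.
Unset Printing Implicit Defensive.

Import GRing.Theory Num.Theory.
Local Open Scope ring_scope.

(** * Derivations and factors of polynomials *)

(** The vector field [t d/dt] on the projective line has simple zeros at 0 and infinity and no
    others; this is why the argument can absorb two common critical values. The obstacle is that on
    the [x]-line [theta] has poles at the ramification points of [P] over all other values, so a
    regular function may have a non-regular derivative. At such a point the fibre of [Q] is
    unramified, and the equation of the curve itself determines the derivative of a factor;
    regularity is therefore proved for all iterates of [theta], by induction on the number of
    derivatives. The orbit of a coefficient then stays among the fractions [a / P2] with [a] of
    bounded degree. Diagonalizability is a residue statement: a Jordan block would give [h] with
    [theta h = 1], that is [dh = dt/t], but [dt/t] has a nonzero residue at infinity. *)

Section FieldDerivation.
Variables (k : fieldType) (th : {additive k -> k}).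
Hypothesis thM : forall x y, th (x * y) = th x * y + x * th y.

Lemma der1 : th 1 = 0.
Proof.
have := thM 1 1; rewrite !mulr1 mul1r => E.
by apply: (addrI (th 1)); rewrite addr0 -E.
Qed.

Lemma map_derM (p q : {poly k}) :
  map_poly th (p * q) = map_poly th p * q + p * map_poly th q.
Proof.
apply/polyP=> i; rewrite coefD coef_map !coefM raddf_sum -big_split /=.
by apply: eq_bigr => j _; rewrite thM !coef_map.
Qed.

Lemma derV x : x != 0 -> th x^-1 = - (th x / x ^+ 2).
Proof.
move=> x0; have := thM x x^-1; rewrite mulfV // der1 => /esym/eqP.
rewrite addrC addr_eq0 => /eqP E; apply: (mulfI x0); rewrite E.
by rewrite mulrN; congr (- _); field.
Qed.

Lemma size_map_der_monic (F : {poly k}) :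
  F \is monic -> (size (map_poly th F) < size F)%N.
Proof.
move=> /monicP Fm; have F0 : F != 0.
  by apply/eqP=> F0; move: Fm; rewrite F0 lead_coef0 => /eqP; rewrite eq_sym oner_eq0.
have sF : (0 < size F)%N by rewrite size_poly_gt0.
rewrite -(prednK sF) ltnS; apply/leq_sizeP => j; rewrite leq_eqVlt.
case/orP=> [/eqP<-|lj]; rewrite coef_map /=.
  by rewrite -lead_coefE Fm der1.
by rewrite nth_default ?raddf0 // -(prednK sF).
Qed.

(** Division by a monic polynomial needs no inverses, so quotient and remainder stay over the
    subring. The induction strips the leading term of [E]. *)
Lemma monic_polyOver (S : subringClosed k) (F E R : {poly k}) :
  F \is monic -> F \is a polyOver S -> (size R < size F)%N ->
  F * E + R \is a polyOver S -> E \is a polyOver S /\ R \is a polyOver S.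
Proof.
move=> Fm FS; have [n] := ubnP (size E); elim: n E => // n IH E sE sR FER.
have [E0|E0] := eqVneq E 0.
  by move: FER; rewrite E0 mulr0 add0r polyOver0.
set m := (size E).-1; set l := lead_coef E.
have sE0 : (0 < size E)%N by rewrite size_poly_gt0.
have sF0 : (0 < size F)%N by rewrite size_poly_gt0 monic_neq0.
have lS : l \in S.
  have := (polyOverP FER) (size F + size E).-2; rewrite coefD.
  rewrite [R`__]nth_default ?addr0.
    have <- : (size (F * E)).-1 = (size F + size E).-2.
      by rewrite size_proper_mul // (monicP Fm) mul1r lead_coef_eq0.
    by rewrite -lead_coefE lead_coef_monicM.
  apply: leq_trans (_ : _ <= (size F).-1)%N _; first by rewrite -ltnS prednK.
  rewrite -(prednK sE0) addnS /= -subn1 -[X in (_ <= X)%N]subn1.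
  by rewrite leq_sub2r ?leq_addr.
pose E' := E - l *: 'X^m.
have lX : l *: 'X^m \is a polyOver S by rewrite polyOverZ // rpredX // polyOverX.
have [||E'S RS] := IH E' _ sR.
- rewrite -ltnS (leq_trans _ sE) // ltnS -(prednK sE0) ltnS.
  apply/leq_sizeP => j; rewrite /E' coefB coefZ coefXn leq_eqVlt.
  case/orP=> [/eqP<-|lj]; first by rewrite eqxx mulr1 -lead_coefE subrr.
  by rewrite gtn_eqF // mulr0 subr0 nth_default // -(prednK sE0).
- have -> : F * E' + R = (F * E + R) - F * (l *: 'X^m) by rewrite /E'; ring.
  by rewrite rpredB // rpredM.
by split=> //; rewrite -[E](subrK (l *: 'X^m)) rpredD.
Qed.

Variable O : subringClosed k.

(** The elements that stay in [O] under up to [j] applications of [th]. In this recursive form the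
    Leibniz rule makes each stage a subring. *)
Fixpoint derclosed (j : nat) : {pred k} :=
  if j is i.+1 then [pred f | (f \in derclosed i) && (th f \in derclosed i)]
  else O.

Lemma derclosedS j f :
  (f \in derclosed j.+1) = (f \in derclosed j) && (th f \in derclosed j).
Proof. by []. Qed.

Lemma derclosed_subring j : subring_closed (derclosed j).
Proof.
elim: j => [|j [IH1 IHB IHM]]; first by split; [exact: rpred1|exact: rpredB|exact: rpredM].
have IHN x : x \in derclosed j -> - x \in derclosed j.
  by move=> xj; rewrite -sub0r IHB // -(subrr x) IHB.
split=> [|x y /andP[xj dxj] /andP[yj dyj]|x y /andP[xj dxj] /andP[yj dyj]].
- by rewrite derclosedS IH1 der1 -(subrr 1) IHB.
- by rewrite derclosedS raddfB !IHB.
by rewrite derclosedS thM IHM // -[X in _ + X]opprK IHB ?IHN // ?IHM.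
Qed.

HB.instance Definition _ j :=
  GRing.isSubringClosed.Build k (derclosed j) (derclosed_subring j).

Lemma derclosed_const j f : f \in O -> th f = 0 -> f \in derclosed j.
Proof.
by move=> fO f0; elim: j => [//|j IH]; rewrite derclosedS IH f0 rpred0.
Qed.

Lemma derclosed_polyOver j (p : {poly k}) :
  (p \is a polyOver (derclosed j.+1)) =
  (p \is a polyOver (derclosed j)) && (map_poly th p \is a polyOver (derclosed j)).
Proof.
apply/polyOverP/andP => [H|[/polyOverP H1 /polyOverP H2] i].
  by split; apply/polyOverP => i; have /andP[] := H i; rewrite ?coef_map.
by rewrite derclosedS H1 -coef_map H2.
Qed.

Lemma derclosed_const_polyOver j (p : {poly k}) :
  p \is a polyOver O -> map_poly th p = 0 -> p \is a polyOver (derclosed j).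
Proof.
move=> /polyOverP pO p0; apply/polyOverP => i; apply: derclosed_const => //.
by rewrite -coef_map p0 coef0.
Qed.

Variables (F W A E : {poly k}).
Hypotheses (Fm : F \is monic) (FO : F \is a polyOver O).
Hypotheses (WO : W \is a polyOver O) (W0 : map_poly th W = 0).
Hypotheses (AO : A \is a polyOver O) (A0 : map_poly th A = 0).
Hypothesis FE : W * map_poly th F + A * F^`() = F * E.
Hypothesis cofactor_polyOver : forall H C : {poly k}, (size H < size F)%N ->
  W * H + F * C \is a polyOver O -> H \is a polyOver O.

(** Since [th] kills [W], differentiating [W * H + F * C] gives a relation of the same shape for the
    derivative of [H], up to the term [map_poly th F * C]. That term is under control because [C] is
    a quotient by the monic [F]. *)
Lemma derclosed_cofactor j (H C : {poly k}) : F \is a polyOver (derclosed j) ->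
  (size H < size F)%N -> W * H + F * C \is a polyOver (derclosed j) ->
  H \is a polyOver (derclosed j).
Proof.
elim: j H C => [|j IH] H C Fj sH; first exact: cofactor_polyOver.
move: Fj; rewrite !derclosed_polyOver => /andP[Fj dFj] /andP[Zj dZj].
have Hj := IH _ _ Fj sH Zj; rewrite Hj andTb.
have Wj := derclosed_const_polyOver j WO W0.
have [||Cj _] := @monic_polyOver (derclosed j) F C 0 Fm Fj.
- by rewrite size_poly0 size_poly_gt0 monic_neq0.
- have -> : F * C + 0 = W * H + F * C - W * H by ring.
  by rewrite rpredB // rpredM.
apply: (IH _ (map_poly th C)) => //.
  by apply: leq_ltn_trans sH; rewrite size_poly.
have -> : W * map_poly th H + F * map_poly th C =
    map_poly th (W * H + F * C) - map_poly th F * C.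
  by rewrite raddfD /= !map_derM W0; ring.
by rewrite rpredB // rpredM.
Qed.

Lemma derclosed_factor j : F \is a polyOver (derclosed j).
Proof.
elim: j => [//|j IH]; rewrite derclosed_polyOver IH andTb.
have Aj := derclosed_const_polyOver j AO A0.
apply: (@derclosed_cofactor j _ (- E)) => //; first exact: size_map_der_monic.
have -> : W * map_poly th F + F * - E = - (A * F^`()).
  by rewrite mulrN -FE; ring.
by rewrite rpredN rpredM // polyOver_deriv.
Qed.

Lemma derclosed_iter j f : f \in derclosed j -> iter j th f \in O.
Proof. by elim: j f => // j IH f /andP[_ ?]; rewrite iterSr IH. Qed.

End FieldDerivation.

(** * Elements with a bounded orbit are sums of eigenvectors *)

Section EigenDecomposition.
Variables (K : closedFieldType) (k : fieldType).
Variables (th : {additive k -> k}) (iota : {rmorphism K -> k}).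
Hypothesis thM : forall x y, th (x * y) = th x * y + x * th y.
Hypothesis thC : forall c, th (iota c) = 0.

Lemma derZ c x : th (iota c * x) = iota c * th x.
Proof. by rewrite thM thC mul0r add0r. Qed.

Lemma iter_derZ i c x : iter i th (iota c * x) = iota c * iter i th x.
Proof. by elim: i => //= i ->; rewrite derZ. Qed.

Lemma iter_derB i x y : iter i th (x - y) = iter i th x - iter i th y.
Proof. by elim: i => //= i ->; rewrite raddfB. Qed.

Definition eigensum (f : k) := exists s : seq (K * k),
  (forall p, p \in s -> th p.2 = iota p.1 * p.2) /\ f = \sum_(p <- s) p.2.

(** The operator [p(th)] applied to [f]. *)
Definition poly_der (p : {poly K}) (f : k) : k :=
  \sum_(i < size p) iota p`_i * iter i th f.

Lemma poly_der_widen n (p : {poly K}) f : (size p <= n)%N ->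
  poly_der p f = \sum_(i < n) iota p`_i * iter i th f.
Proof.
move=> sp; rewrite /poly_der.
rewrite (big_ord_widen n (fun i => iota p`_i * iter i th f) sp) big_mkcond /=.
apply: eq_bigr => i _; case: ltnP => // ?.
by rewrite nth_default // rmorph0 mul0r.
Qed.

Lemma poly_der_linear c (p : {poly K}) f :
  poly_der (('X - c%:P) * p) f = poly_der p (th f - iota c * f).
Proof.
have s1 : (size (('X - c%:P) * p)%R <= (size p).+1)%N.
  by rewrite (leq_trans (size_polyMleq _ _)) // size_XsubC.
rewrite (poly_der_widen _ s1) /poly_der.
transitivity (\sum_(i < size p) iota p`_i * iter i.+1 th f
   - \sum_(i < (size p).+1) iota (c * p`_i) * iter i th f).
  under eq_bigr => i _ do rewrite mulrBl coefB coefXM coefCM rmorphB mulrBl.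
  by rewrite sumrB big_ord_recl /= rmorph0 mul0r add0r.
rewrite big_ord_recr /= nth_default // mulr0 rmorph0 mul0r addr0 -sumrB.
apply: eq_bigr => i _.
by rewrite iter_derB iter_derZ -iterSr rmorphM /= mulrBr; ring.
Qed.

Hypothesis no_jordan : forall c f g,
  th g = iota c * g -> th f - iota c * f = g -> g = 0.

(** Summands with eigenvalue other than [c] lift through [th - c] by division; [h] collects these
    lifts. The rest [g] has eigenvalue [c] and is killed by [no_jordan], so [f - h] is an
    eigenvector for [c]. *)
Lemma eigensum_shift c f : eigensum (th f - iota c * f) -> eigensum f.
Proof.
case=> s [sE fE]; pose s1 := [seq p <- s | p.1 != c].
pose s' := [seq (p.1, p.2 / iota (p.1 - c)) | p <- s1].
have s'E p : p \in s' -> th p.2 = iota p.1 * p.2.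
  case/mapP=> q; rewrite mem_filter => /andP[_ qs] -> /=.
  by rewrite mulrC -fmorphV derZ (sE _ qs); ring.
pose h := \sum_(p <- s') p.2.
pose g := \sum_(p <- s | p.1 == c) p.2.
have hE : th h - iota c * h = \sum_(p <- s | p.1 != c) p.2.
  rewrite /h big_map big_filter raddf_sum mulr_sumr -sumrB.
  rewrite big_seq_cond [RHS]big_seq_cond; apply: eq_bigr => p /andP[ps pc] /=.
  rewrite mulrC -fmorphV derZ (sE _ ps) fmorphV rmorphB /=.
  have : iota p.1 - iota c != 0 by rewrite -rmorphB fmorph_eq0 subr_eq0.
  by move=> ?; field.
have gE : th g = iota c * g.
  rewrite /g raddf_sum mulr_sumr big_seq_cond [RHS]big_seq_cond.
  by apply: eq_bigr => p /andP[ps /eqP pc] /=; rewrite (sE _ ps) pc.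
have fhE : th (f - h) - iota c * (f - h) = g.
  rewrite raddfB /=; have -> : th f - th h - iota c * (f - h) =
    (th f - iota c * f) - (th h - iota c * h) by ring.
  by rewrite fE hE /g (bigID (fun p => p.1 == c)) /= addrK.
have g0 := no_jordan gE fhE.
exists ((c, f - h) :: s'); split.
  move=> p; rewrite inE => /orP[/eqP->/=|/s'E//].
  by apply/eqP; rewrite -subr_eq0 fhE g0.
by rewrite big_cons /= -/h subrK.
Qed.

Lemma poly_der_eigensum p f : p != 0 -> poly_der p f = 0 -> eigensum f.
Proof.
have [r {2}->] := closed_field_poly_normal p.
rewrite -lead_coef_eq0; move: (lead_coef p) => a a0 {p}.
rewrite /poly_der size_scale // => H.
have {H} : poly_der (\prod_(z <- r) ('X - z%:P)) f = 0.
  apply: (@mulfI _ (iota a)); first by rewrite fmorph_eq0.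
  rewrite mulr0 -H mulr_sumr; apply: eq_bigr => i _.
  by rewrite coefZ rmorphM mulrA.
elim: r f => [|c r IH] f.
  rewrite big_nil /poly_der size_poly1 big_ord1 coef1 rmorph1 mul1r /= => ->.
  by exists [::]; split=> //; rewrite big_nil.
by rewrite big_cons poly_der_linear => /IH/eigensum_shift.
Qed.

(** The first [N + 1] iterates come from a space of dimension [N], so they are dependent and a
    nonzero polynomial in [th] annihilates [f]. *)
Lemma bounded_orbit_eigensum (phi : {additive {poly K} -> k}) N f :
  (forall c p, phi (c *: p) = iota c * phi p) ->
  (forall j, exists2 a : {poly K}, (size a <= N)%N & iter j th f = phi a) ->
  eigensum f.
Proof.
move=> phiZ orb; pose v j := projT1 (cid2 (orb j)).
have sv j : (size (v j) <= N)%N by rewrite /v; case: cid2.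
have vE j : iter j th f = phi (v j) by rewrite /v; case: cid2.
pose M := \matrix_(i < N.+1) (poly_rV (v i) : 'rV[K]_N).
have /rowV0Pn[w] : kermx M != 0.
  by rewrite -mxrank_eq0 mxrank_ker subn_eq0 -ltnNge ltnS rank_leq_col.
move=> /sub_kermxP wM w0.
have p0 : rVpoly w != 0.
  by apply: contraNneq w0 => w0; rewrite -(rVpolyK w) w0 linear0.
apply: (poly_der_eigensum p0).
rewrite (@poly_der_widen N.+1) ?size_poly //.
transitivity (phi (rVpoly (w *m M))); last by rewrite wM !linear0 raddf0.
rewrite mulmx_sum_row linear_sum raddf_sum; apply: eq_bigr => i _ /=.
rewrite linearZ /= phiZ rowK poly_rV_K ?sv // vE; congr (iota _ * _).
by rewrite coef_rVpoly_ord.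
Qed.

End EigenDecomposition.

(** * The Euler derivation of a rational function field *)

(** Here [m] and [n] are formal degrees: the top coefficients may vanish, as values at infinity
    may. *)
Lemma coefM_top (R : nzRingType) (p q : {poly R}) m n :
  (size p <= m.+1)%N -> (size q <= n.+1)%N ->
  (p * q)`_(m + n) = p`_m * q`_n.
Proof.
move=> sp sq; have mn : (m < (m + n).+1)%N by rewrite ltnS leq_addr.
rewrite coefM (bigD1 (Ordinal mn)) //= addKn big1 ?addr0 // => i.
rewrite -val_eqE /= neq_ltn => /orP[im|mi].
  by rewrite [q`__]nth_default ?mulr0 // (leq_trans sq) // ltn_subRL ltn_add2r.
by rewrite [p`__]nth_default ?mul0r // (leq_trans sp).
Qed.

Lemma sizeM_top (R : nzRingType) (p q : {poly R}) m n :
  (size p <= m.+1)%N -> (size q <= n.+1)%N ->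
  (size (p * q)%R <= (m + n).+1)%N.
Proof.
move=> sp sq; apply: leq_trans (size_polyMleq _ _) _.
by rewrite -ltnS -addSn -addnS; case: (_ + _)%N (leq_add sp sq).
Qed.

Section Wronskian.
Variable K : numClosedFieldType.
Implicit Types a b p q : {poly K}.

Definition wronsk a b := a^`() * b - a * b^`().

(** Unlike [d/dx], the operator ['X * d/dx] keeps formal degrees; hence Wronskians are always
    measured after multiplication by ['X]. *)
Lemma sizeX_deriv p n : (size p <= n.+1)%N -> (size ('X * p^`())%R <= n.+1)%N.
Proof.
move=> sp; apply/leq_sizeP => [[//|j]] nj; rewrite coefXM coef_deriv /=.
by rewrite nth_default ?mul0rn // (leq_trans sp).
Qed.

Lemma coefX_deriv p n : ('X * p^`())`_n = p`_n *+ n.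
Proof. by case: n => [|n]; rewrite coefXM ?mulr0n // coef_deriv. Qed.

Lemma wronskX a b : 'X * wronsk a b = ('X * a^`()) * b - a * ('X * b^`()).
Proof. by rewrite /wronsk; ring. Qed.

Lemma sizeX_wronsk a b m n : (size a <= m.+1)%N -> (size b <= n.+1)%N ->
  (size ('X * wronsk a b)%R <= (m + n).+1)%N.
Proof.
move=> sa sb; rewrite wronskX (leq_trans (size_polyD _ _)) // size_polyN geq_max.
by rewrite !sizeM_top ?sizeX_deriv.
Qed.

(** When the degrees are exact, [m - n] is the order of the pole of [a / b] at infinity, so this
    coefficient records the logarithmic derivative there. *)
Lemma coefX_wronsk a b m n : (size a <= m.+1)%N -> (size b <= n.+1)%N ->
  ('X * wronsk a b)`_(m + n) = (m%:R - n%:R) * (a`_m * b`_n).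
Proof.
move=> sa sb; rewrite wronskX coefB !coefM_top ?sizeX_deriv // !coefX_deriv.
by rewrite -[_ *+ m]mulr_natl -[_ *+ n]mulr_natl; ring.
Qed.

Lemma deriv_eq0 p : p^`() = 0 -> p = (p`_0)%:P.
Proof.
move=> p0; apply/polyP=> [[|i]]; rewrite coefC //=.
have := coef_deriv p i; rewrite p0 coef0 => /esym/eqP.
by rewrite mulrn_eq0 => /eqP.
Qed.

(** By coprimality [b] divides its own derivative, which has smaller degree and must vanish; in
    characteristic 0 this makes [b] constant. *)
Lemma wronsk_eq0 a b : b != 0 -> coprimep a b -> wronsk a b = 0 ->
  a = (a`_0)%:P /\ b = (b`_0)%:P.
Proof.
move=> b0 ab /eqP; rewrite subr_eq0 => /eqP E.
have : b %| a * b^`() by rewrite -E dvdp_mull.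
rewrite Gauss_dvdpr 1?coprimep_sym // => bb'.
have b'0 : b^`() = 0.
  apply/eqP; apply: contraTT bb' => b'0; rewrite gtNdvdp //.
  exact: lt_size_deriv.
move: E; rewrite b'0 mulr0 => /eqP; rewrite mulf_eq0 (negPf b0) orbF => /eqP a'0.
by split; apply: deriv_eq0.
Qed.

End Wronskian.

(** This makes the quotient rule independent of the chosen fraction. Primed letters stand for
    derivatives, and the last hypothesis is the derivative of [p * d = n * q]. *)
Lemma quotient_rule (k : fieldType) (p q n d p' q' n' d' : k) :
  q != 0 -> d != 0 -> p * d = n * q -> p' * d + p * d' = n' * q + n * q' ->
  (p' * q - p * q') / q ^+ 2 = (n' * d - n * d') / d ^+ 2.
Proof.
move=> q0 d0 E E'; pose f := n / d.
have pE : p = f * q by rewrite /f mulrAC -E mulfK.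
have nE : n = f * d by rewrite /f divfK.
have {}E' : (p' - f * q') * d = (n' - f * d') * q.
  apply/eqP; rewrite -subr_eq0; apply/eqP.
  transitivity (p' * d + p * d' - (n' * q + n * q')); last by rewrite E' subrr.
  by rewrite pE nE; ring.
have -> : (p' * q - p * q') / q ^+ 2 = (p' - f * q') / q by rewrite pE; field.
have -> : (n' * d - n * d') / d ^+ 2 = (n' - f * d') / d by rewrite nE; field.
by apply/eqP; rewrite eqr_div // E'.
Qed.

Lemma quotient_ruleB (k : fieldType) (a b c d a' b' c' d' : k) :
  b != 0 -> d != 0 ->
  ((a' * d + a * d' - (c' * b + c * b')) * (b * d)
    - (a * d - c * b) * (b' * d + b * d')) / (b * d) ^+ 2 =
  (a' * b - a * b') / b ^+ 2 - (c' * d - c * d') / d ^+ 2.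
Proof. by move=> b0 d0; field; rewrite ?b0 ?d0. Qed.

Lemma quotient_ruleM (k : fieldType) (a b c d a' b' c' d' : k) :
  b != 0 -> d != 0 ->
  ((a' * c + a * c') * (b * d) - (a * c) * (b' * d + b * d')) / (b * d) ^+ 2 =
  (a' * b - a * b') / b ^+ 2 * (c / d) + a / b * ((c' * d - c * d') / d ^+ 2).
Proof. by move=> b0 d0; field; rewrite ?b0 ?d0. Qed.

Lemma subf_div (k : fieldType) (a b c d : k) : b != 0 -> d != 0 ->
  a / b - c / d = (a * d - c * b) / (b * d).
Proof. by move=> b0 d0; rewrite -mulNr addf_div // mulNr. Qed.

Lemma ratfunP (K : fieldType) (f : ratfun K) :
  exists a b : {poly K}, [/\ b != 0, coprimep a b & f = a%:F / b%:F].
Proof.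
exists (ratnum f), (ratden f).
by split; [exact: ratden_neq0 | exact: coprimep_ratnum_ratden | exact: ratfunE].
Qed.

Lemma tofrac_cross (R : idomainType) (a b c d : R) : b != 0 -> d != 0 ->
  a%:F / b%:F = c%:F / d%:F -> a * d = c * b.
Proof.
move=> b0 d0 E; apply/eqP; rewrite -tofrac_eq !tofracM; apply/eqP.
have b0' : b%:F != 0 by rewrite tofrac_eq0.
have d0' : d%:F != 0 by rewrite tofrac_eq0.
by rewrite -[a%:F](divfK b0') -[c%:F](divfK d0') E mulrAC.
Qed.

Lemma tofrac_div_eq (R : idomainType) (a b c d : R) : b != 0 -> d != 0 ->
  a * d = c * b -> a%:F / b%:F = c%:F / d%:F.
Proof.
move=> b0 d0 E.
have b0' : b%:F != 0 by rewrite tofrac_eq0.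
have d0' : d%:F != 0 by rewrite tofrac_eq0.
apply: (canLR (mulfK b0')); rewrite mulrAC; apply: (canRL (mulfK d0')).
by rewrite -!tofracM E.
Qed.

Section RatDer.
Variable K : numClosedFieldType.
Notation k := (ratfun K).
Implicit Types (f g : k) (a b : {poly K}).

Definition cst : {rmorphism K -> k} := (@tofrac {poly K}) \o polyC.

Definition ratder f : k :=
  (wronsk (ratnum f) (ratden f))%:F / (ratden f)%:F ^+ 2.

Lemma ratderE a b : b != 0 -> ratder (a%:F / b%:F) = (wronsk a b)%:F / b%:F ^+ 2.
Proof.
move=> b0; move FE : (a%:F / b%:F) => f.
have d0 := ratden_neq0 f.
have b0' : b%:F != 0 by rewrite tofrac_eq0.
have d0' : (ratden f)%:F != 0 by rewrite tofrac_eq0.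
have E : a * ratden f = ratnum f * b.
  apply/eqP; rewrite -tofrac_eq !tofracM; apply/eqP.
  have fb : f * b%:F = a%:F by rewrite -FE (divfK b0').
  have fd : f * (ratden f)%:F = (ratnum f)%:F.
    by rewrite [X in X * _]ratfunE (divfK d0').
  by rewrite -fb -fd mulrAC.
have E1 : a%:F * (ratden f)%:F = (ratnum f)%:F * b%:F by rewrite -!tofracM E.
have E2 : a^`()%:F * (ratden f)%:F + a%:F * (ratden f)^`()%:F =
    (ratnum f)^`()%:F * b%:F + (ratnum f)%:F * b^`()%:F.
  by rewrite -!tofracM -!tofracD -!derivM E.
rewrite /ratder /wronsk (tofracB (_ * ratden f)) (tofracB (_ * b)) !tofracM.
exact: (esym (quotient_rule b0' d0' E1 E2)).
Qed.

Lemma ratder_is_zmod_morphism : zmod_morphism ratder.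
Proof.
move=> f g; have [a [b [b0 _ ->]]] := ratfunP f; have [c [d [d0 _ ->]]] := ratfunP g.
have b0' : b%:F != 0 by rewrite tofrac_eq0.
have d0' : d%:F != 0 by rewrite tofrac_eq0.
rewrite (subf_div _ _ b0' d0').
rewrite -(tofracM a d) -(tofracM c b) -(tofracM b d) -(tofracB (a * d)).
rewrite (ratderE _ (mulf_neq0 b0 d0)) (ratderE _ b0) (ratderE _ d0).
rewrite /wronsk derivB !derivM !(tofracB, tofracM, tofracD).
exact: (quotient_ruleB _ _ _ _ _ _ b0' d0').
Qed.

HB.instance Definition _ :=
  GRing.isZmodMorphism.Build k k ratder ratder_is_zmod_morphism.

Lemma ratderM f g : ratder (f * g) = ratder f * g + f * ratder g.
Proof.
have [a [b [b0 _ ->]]] := ratfunP f; have [c [d [d0 _ ->]]] := ratfunP g.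
have b0' : b%:F != 0 by rewrite tofrac_eq0.
have d0' : d%:F != 0 by rewrite tofrac_eq0.
rewrite mulf_div -(tofracM a c) -(tofracM b d).
rewrite (ratderE _ (mulf_neq0 b0 d0)) (ratderE _ b0) (ratderE _ d0).
rewrite /wronsk !derivM !(tofracB, tofracM, tofracD).
exact: (quotient_ruleM _ _ _ _ _ _ b0' d0').
Qed.

Lemma ratder_eq0 f : ratder f = 0 -> exists c, f = cst c.
Proof.
have [a [b [b0 ab ->]]] := ratfunP f; rewrite ratderE // => /eqP.
have b0' : b%:F != 0 by rewrite tofrac_eq0.
rewrite mulf_eq0 invr_eq0 expf_eq0 (negPf b0') /= orbF tofrac_eq0 => /eqP w0.
have [aE bE] := wronsk_eq0 b0 ab w0; exists (a`_0 / b`_0).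
by rewrite {1}aE {1}bE -[RHS]/(cst _) rmorphM fmorphV.
Qed.

Lemma ratder_cst c : ratder (cst c) = 0.
Proof.
have -> : cst c = c%:P%:F / 1%:F by rewrite tofrac1 divr1.
rewrite (ratderE _ (oner_neq0 _)) /wronsk derivC -[1]/(1%:P) derivC mul0r mulr0.
by rewrite subrr tofrac0 mul0r.
Qed.

End RatDer.

(* [theta] is the derivation [t d/dt] of [K(t)], [t = P1 / P2], extended to
   [K(x)]. *)
Section Theta.
Variables (K : numClosedFieldType) (P1 P2 : {poly K}).
Hypotheses (P2_neq0 : P2 != 0) (sP : (size P2 < size P1)%N).
Notation k := (ratfun K).
Notation w := (wronsk P1 P2).
Notation t := (P1%:F / P2%:F : k).
Notation d1 := (size P1).-1.
Notation d2 := (size P2).-1.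
Implicit Types (f g : k) (a b : {poly K}).

Definition theta f : k := t / ratder t * ratder f.

Lemma theta_is_zmod_morphism : zmod_morphism theta.
Proof. by move=> f g; rewrite /theta raddfB mulrBr. Qed.

HB.instance Definition _ :=
  GRing.isZmodMorphism.Build k k theta theta_is_zmod_morphism.

Lemma thetaM f g : theta (f * g) = theta f * g + f * theta g.
Proof. by rewrite /theta ratderM mulrDr mulrA [in X in _ + X]mulrCA. Qed.

Lemma theta_cst c : theta (cst K c) = 0.
Proof. by rewrite /theta ratder_cst mulr0. Qed.

Lemma P1_neq0 : P1 != 0.
Proof. by rewrite -size_poly_gt0 (leq_trans _ sP). Qed.

Lemma size_predK a : a != 0 -> (size a).-1.+1 = size a.
Proof. by move=> a0; rewrite prednK // size_poly_gt0. Qed.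

Lemma ltn_d : (d2 < d1)%N.
Proof. by rewrite -ltnS !size_predK ?P1_neq0. Qed.

Lemma natr_d_neq0 : d1%:R - d2%:R != 0 :> K.
Proof. by rewrite subr_eq0 eqr_nat gtn_eqF // ltn_d. Qed.

Lemma coefX_w : ('X * w)`_(d1 + d2) = (d1%:R - d2%:R) * (lead_coef P1 * lead_coef P2).
Proof. by rewrite coefX_wronsk ?size_predK ?P1_neq0. Qed.

Lemma coefX_w_neq0 : ('X * w)`_(d1 + d2) != 0.
Proof.
by rewrite coefX_w mulf_neq0 ?natr_d_neq0 // mulf_neq0 // lead_coef_eq0 ?P1_neq0.
Qed.

Lemma w_neq0 : w != 0.
Proof. by apply: contraNneq coefX_w_neq0 => ->; rewrite mulr0 coef0. Qed.

Lemma size_w : size ('X * w) = (d1 + d2).+1.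
Proof.
apply/anti_leq; rewrite sizeX_wronsk ?size_predK ?P1_neq0 //=.
by rewrite ltnNge; apply/negP => /leq_sizeP/(_ _ (leqnn _))/eqP; apply/negP/coefX_w_neq0.
Qed.

Lemma tofrac_neq0 a : a != 0 -> (a%:F : k) != 0.
Proof. by rewrite tofrac_eq0. Qed.

Lemma theta_t : theta t = t.
Proof.
rewrite /theta divfK // ratderE // mulf_neq0 ?invr_eq0 ?expf_neq0 //.
  exact/tofrac_neq0/w_neq0.
exact: tofrac_neq0.
Qed.

Lemma theta_fracE a b : b != 0 ->
  theta (a%:F / b%:F) = (P1 * P2 * wronsk a b)%:F / (w * b ^+ 2)%:F.
Proof.
move=> b0; rewrite /theta !ratderE // !tofracM.
move: (tofrac_neq0 b0) (tofrac_neq0 P2_neq0) (tofrac_neq0 w_neq0).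
move: (a%:F) (b%:F) (P1%:F) (P2%:F) (w%:F) ((wronsk a b)%:F).
have E (F : fieldType) (A B p q W c : F) : B != 0 -> q != 0 -> W != 0 ->
    p / q / (W / q ^+ 2) * (c / B ^+ 2) = p * q * c / (W * B ^+ 2).
  by move=> B0 q0 W0; field; rewrite ?B0 ?q0 ?W0.
by move=> A B p q W c; apply: E.
Qed.

Lemma theta_eq0 f : theta f = 0 -> exists c, f = cst K c.
Proof.
move=> /eqP; rewrite mulf_eq0 => /orP[|/eqP/ratder_eq0//].
rewrite mulf_eq0 invr_eq0 => /orP[/eqP t0|/eqP r0].
  have := P1_neq0; rewrite -tofrac_eq0.
  by move/eqP: t0; rewrite mulf_eq0 invr_eq0 !tofrac_eq0 (negPf P2_neq0) orbF => ->.
move: r0; rewrite ratderE // => /eqP.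
rewrite mulf_eq0 invr_eq0 expf_eq0 !tofrac_eq0 (negPf P2_neq0) andbF orbF.
by rewrite (negPf w_neq0).
Qed.

Lemma sizeM_pred a b : a != 0 -> b != 0 ->
  (size (a * b)%R <= ((size a).-1 + (size b).-1).+1)%N.
Proof. by move=> a0 b0; rewrite sizeM_top ?size_predK. Qed.

Lemma coefM_lead a b : a != 0 -> b != 0 ->
  (a * b)`_((size a).-1 + (size b).-1) = lead_coef a * lead_coef b.
Proof. by move=> a0 b0; rewrite coefM_top ?size_predK. Qed.

(* Comparing orders at infinity, where [t] has a pole of order [d1 - d2]. *)
Lemma theta_eigen_degree c a b : a != 0 -> b != 0 ->
  theta (a%:F / b%:F) = cst K c * (a%:F / b%:F) ->
  (size a).-1%:R - (size b).-1%:R = c * (d1%:R - d2%:R).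
Proof.
move=> a0 b0; rewrite theta_fracE // => E.
have {}E : P1 * P2 * wronsk a b = c *: (w * (a * b)).
  apply: (mulIf b0); have := E; rewrite -[cst K c]/(c%:P%:F).
  rewrite (mulrA c%:P%:F) -tofracM => /tofrac_cross.
  by rewrite mulf_neq0 ?w_neq0 ?expf_neq0 // => -> //; rewrite -mul_polyC; ring.
have := congr1 (fun p => ('X * p)`_((d1 + d2) + ((size a).-1 + (size b).-1))) E.
rewrite /= mulrCA coefM_top ?sizeM_pred ?sizeX_wronsk ?size_predK ?P1_neq0 //.
rewrite coefX_wronsk ?size_predK // coefM_lead ?P1_neq0 //.
rewrite -scalerAr coefZ (mulrA 'X) coefM_top ?size_w ?sizeM_pred // coefX_w coefM_lead // => {E}E.
apply: (@mulIf _ (lead_coef P1 * lead_coef P2 * (lead_coef a * lead_coef b))).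
  by rewrite !mulf_neq0 ?lead_coef_eq0 ?P1_neq0.
by move: E; rewrite -/(lead_coef a) -/(lead_coef b) => E; rewrite mulrCA E; ring.
Qed.

(** For [g] nonzero, [f / g] would have derivative 1 under [theta], which the orders at infinity
    forbid. *)
Lemma theta_no_jordan c f g :
  theta g = cst K c * g -> theta f - cst K c * f = g -> g = 0.
Proof.
move=> gE fE; apply/eqP; apply: contraT => g0.
have hE : theta (f / g) = 1.
  have dV : theta g^-1 = - (theta g / g ^+ 2) := derV thetaM g0.
  rewrite thetaM dV gE; move/eqP: fE; rewrite subr_eq => /eqP->.
  have E (F : fieldType) (x y z : F) : y != 0 ->
    (y + z * x) / y + x * - (z * y / y ^+ 2) = 1.
    by move=> y0; field; rewrite ?y0.
  exact: E.
have [a [b [b0 _ hab]]] := ratfunP (f / g).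
have a0 : a != 0.
  apply: contra_eq_neq hE => a0; rewrite hab a0 tofrac0 mul0r raddf0 eq_sym.
  exact: oner_neq0.
move: hE; rewrite hab theta_fracE // => E.
have {}E : P1 * P2 * wronsk a b = w * b ^+ 2.
  rewrite -tofrac1 -[RHS]divr1 -[X in _ = _ / X]tofrac1 in E.
  have := tofrac_cross _ _ E; rewrite mulr1 mul1r.
  by rewrite mulf_neq0 ?w_neq0 ?expf_neq0 ?oner_neq0 // => ->.
have l0 (p : {poly K}) : p != 0 -> lead_coef p != 0 by rewrite lead_coef_eq0.
have P10 := P1_neq0.
have Rb : ('X * (w * b ^+ 2))`_(d1 + d2 + ((size b).-1 + (size b).-1)) != 0.
  rewrite (mulrA 'X) expr2 coefM_top ?size_w ?sizeM_pred // coefM_lead // coefX_w.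
  by rewrite !mulf_neq0 ?natr_d_neq0 ?l0.
have La : ('X * (P1 * P2 * wronsk a b))`_(d1 + d2 + ((size a).-1 + (size b).-1)) =
   lead_coef P1 * lead_coef P2 *
   (((size a).-1%:R - (size b).-1%:R) * (lead_coef a * lead_coef b)).
  rewrite mulrCA coefM_top ?sizeM_pred ?sizeX_wronsk ?size_predK //.
  by rewrite coefX_wronsk ?size_predK // coefM_lead.
(* With unequal degrees the two sides of [E] have different degrees. With equal degrees the top
   coefficient on the left carries the factor [deg a - deg b = 0], while the one on the right is
   [Rb]. *)
case: (ltngtP (size a).-1 (size b).-1) => ab.
- case/negP: Rb; rewrite -E mulrCA nth_default //.
  apply: leq_trans (_ : _ <= (d1 + d2 + ((size a).-1 + (size b).-1)).+1)%N _.
    by rewrite sizeM_top ?sizeM_pred ?sizeX_wronsk ?size_predK.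
  by rewrite -addnS leq_add2l -addSn leq_add2r.
- move: La; rewrite E (mulrA 'X) nth_default.
    move/esym/eqP; rewrite !mulf_eq0 subr_eq0 eqr_nat !lead_coef_eq0.
    by rewrite (negPf P10) (negPf P2_neq0) (negPf a0) (negPf b0) gtn_eqF.
  apply: leq_trans (_ : _ <= (d1 + d2 + ((size b).-1 + (size b).-1)).+1)%N _.
    by rewrite expr2 sizeM_top ?size_w ?sizeM_pred.
  by rewrite -addnS leq_add2l -addSn leq_add2r.
by move: La; rewrite ab subrr mul0r mulr0 -[in X in X = _ -> _]ab E => /eqP; rewrite ab (negPf Rb).
Qed.

End Theta.

(** * Eigenfunctions as powers of one root of [t] *)

Section EigenRoot.
Variables (K : numClosedFieldType) (k : fieldType).
Variables (th : {additive k -> k}) (iota : {rmorphism K -> k}).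
Hypothesis thM : forall x y, th (x * y) = th x * y + x * th y.
Hypothesis th_eq0 : forall f, th f = 0 -> exists c, f = iota c.
Variables (t : k) (e : nat).
Hypotheses (t_neq0 : t != 0) (th_t : th t = t) (e_gt0 : (0 < e)%N).
Hypothesis eigenvalue_rational : forall f c, f != 0 -> th f = iota c * f ->
  exists n : int, c * e%:R = n%:~R.

Let eR_neq0 : (e%:R : k) != 0.
Proof.
by rewrite -(rmorph_nat (iota)) fmorph_eq0 pnatr_eq0 -lt0n.
Qed.

Let ld f := th f / f.

Let ldM f g : f != 0 -> g != 0 -> ld (f * g) = ld f + ld g.
Proof.
move=> f0 g0; rewrite /ld thM; move: (th f) (th g) => x y.
have E (F : fieldType) (a b c d : F) : a != 0 -> b != 0 ->
  (c * b + a * d) / (a * b) = c / a + d / b.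
  by move=> a0 b0; field; rewrite ?a0 ?b0.
exact: (E _ _ _ _ _ f0 g0).
Qed.

Let ld1 : ld 1 = 0.
Proof. by rewrite /ld (der1 thM) mul0r. Qed.

Let ldV f : f != 0 -> ld f^-1 = - ld f.
Proof.
move=> f0; apply/eqP; rewrite -addr_eq0 addrC.
by rewrite -ldM ?invr_eq0 // mulfV // ld1.
Qed.

Let ldXn f n : f != 0 -> ld (f ^+ n) = ld f *+ n.
Proof.
move=> f0; elim: n => [|n IH]; first by rewrite expr0 ld1.
by rewrite exprS ldM ?expf_neq0 // IH mulrS.
Qed.

Let ldXz f (j : int) : f != 0 -> ld (f ^ j) = ld f *~ j.
Proof.
move=> f0; case: j => n; first exact: ldXn.
by rewrite NegzE -exprnN -exprVn ldXn ?invr_eq0 // ldV // mulrNz mulNrn.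
Qed.

(** The logarithmic derivative of [f] is [n / e]. Weights add under products, so those that occur
    form a subgroup of the integers. *)
Let weight f (n : int) := f != 0 /\ e%:R * ld f = n%:~R.

Let weightM f g m n : weight f m -> weight g n -> weight (f * g) (m + n).
Proof.
move=> [f0 fm] [g0 gn]; split; first exact: (mulf_neq0 f0 g0).
by rewrite ldM // mulrDr fm gn -intrD.
Qed.

Let weightX f m j : weight f m -> weight (f ^ j) (m * j).
Proof.
move=> [f0 fm]; split; first exact: expfz_neq0.
by rewrite ldXz // -mulrzr mulrA fm -intrM.
Qed.

Let weight_t : weight t e.
Proof.
by split=> //; rewrite /ld th_t divff ?mulr1.
Qed.

Let weight0 f : weight f 0 -> exists c, f = iota c.
Proof.
case=> f0 /eqP; rewrite mulf_eq0 (negPf eR_neq0) /= /ld mulf_eq0 invr_eq0.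
by rewrite (negPf f0) orbF => /eqP/th_eq0.
Qed.

Let eigen_weight f c : f != 0 -> th f = iota c * f -> exists n, weight f n.
Proof.
move=> f0 E; have [n cn] := eigenvalue_rational f0 E; exists n; split=> //.
by rewrite /ld E mulfK // -(rmorph_int iota) -cn rmorphM rmorph_nat mulrC.
Qed.

(** The group of weights is generated by its least positive element [g], the weight of some [u0].
    Dividing an eigenfunction by the matching power of [u0] leaves weight 0, hence a constant; this
    applies to [t], whose weight is [e]. *)
Lemma eigen_root : exists m u, [/\ (0 < m)%N, u != 0, u ^+ m = t &
  forall f c, f != 0 -> th f = iota c * f ->
  exists b (j : int), f = iota b * u ^ j].
Proof.
have ex : exists n, (0 < n)%N && `[< exists f, weight f n >].
  by exists e; rewrite e_gt0; apply/asboolP; exists t.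
case: (ex_minnP ex) => g /andP[g0 /asboolP[u0 u0g]] gmin.
have dvg f n : weight f n -> exists q b, n = q * g%:Z /\ f = iota b * u0 ^ q.
  move=> fn; have g0Z : g%:Z != 0 by rewrite eqz_nat -lt0n.
  have := weightM fn (weightX (- (n %/ g)%Z) u0g).
  have -> : n + g%:Z * - (n %/ g)%Z = (n %% g)%Z.
    by rewrite {1}(divz_eq n g) mulrN [_ * g%:Z]mulrC addrAC subrr add0r.
  have := modz_ge0 n g0Z; have : ((n %% g)%Z < g%:Z)%R by apply: ltz_pmod.
  case: (n %% g)%Z (divz_eq n g) => // r nE rg _ fr.
  have r0 : r = 0%N.
    apply/eqP; rewrite -leqn0 leqNgt; apply/negP => r_gt0.
    have := gmin r; rewrite r_gt0 /= leqNgt -ltz_nat rg => /(_ _)/negP; apply=> //.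
    by apply/asboolP; eexists; exact: fr.
  move: fr nE; rewrite r0 addr0 => /weight0[b fb] nE.
  exists (n %/ g)%Z, b; split=> //; rewrite -fb -mulrA -expfzDr.
    by rewrite addNr expr0z mulr1.
  by case: u0g.
have [q [b [eg tE]]] := dvg _ _ weight_t.
have q0 : (0 < q)%R by rewrite -(pmulr_lgt0 q (_ : 0 < g%:Z)%R) ?ltz_nat // -eg ltz_nat.
case: q q0 eg tE => // m m0 eg tE.
have b0 : b != 0 by apply: contraNneq t_neq0 => b0; rewrite tE b0 rmorph0 mul0r.
(* Rescaling [u0] by an [m]-th root of [b] turns [t = b * u0 ^ m] into an exact power. *)
pose c := m.-root b; have cb : c ^+ m = b by rewrite rootCK.
have c0 : c != 0 by apply: contraNneq b0 => c0; rewrite -cb c0 expr0n gtn_eqF.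
have cc0 : iota c != 0 by rewrite fmorph_eq0.
have u00 : u0 != 0 by case: u0g.
exists m, (iota c * u0); split=> //; first by rewrite mulf_neq0.
  by rewrite exprMn -rmorphXn cb tE.
move=> f d f0 /(eigen_weight f0)[n /dvg[q [b' [_ ->]]]].
exists (b' * c ^ (- q)), q.
rewrite exprzMl ?unitfE // mulrA; congr (_ * _).
by rewrite rmorphM fmorphXz -mulrA -expfzDr // addNr expr0z mulr1.
Qed.

End EigenRoot.

Section ThetaRoot.
Variables (K : numClosedFieldType) (P1 P2 : {poly K}).
Hypotheses (P2_neq0 : P2 != 0) (sP : (size P2 < size P1)%N).
Notation k := (ratfun K).
Notation t := (P1%:F / P2%:F : k).
Notation th := (theta P1 P2).

Lemma theta_root : exists m (u : k), [/\ (0 < m)%N, u != 0, u ^+ m = t &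
  forall f c, f != 0 -> th f = cst K c * f ->
  exists b (j : int), f = cst K b * u ^ j].
Proof.
(* The order of the pole of [t] at infinity; every eigenvalue is a pole order at infinity divided by
   it. *)
have e_gt0 : (0 < (size P1).-1 - (size P2).-1)%N by rewrite subn_gt0 ltn_d.
have t0 : t != 0.
  by rewrite mulf_neq0 ?invr_eq0 ?tofrac_eq0 // (P1_neq0 sP).
apply: (eigen_root (@thetaM K P1 P2) (theta_eq0 P2_neq0 sP) t0 _ e_gt0).
  exact: theta_t.
move=> f c f0; have [a [b [b0 _ fE]]] := ratfunP f => E.
have a0 : a != 0 by apply: contraNneq f0 => a0; rewrite fE a0 tofrac0 mul0r.
exists ((size a).-1%:Z - (size b).-1%:Z).
move: E; rewrite fE => /(theta_eigen_degree P2_neq0 sP a0 b0) E.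
by rewrite (natrB _ (ltnW (ltn_d P2_neq0 sP))) -E intrB.
Qed.

End ThetaRoot.

(** * Regularity of the coefficients of a factor *)

Section FactorDerivation.
Variables (K : numClosedFieldType) (k : fieldType).
Variables (th : {additive k -> k}) (iota : {rmorphism K -> k}).
Hypothesis thM : forall x y, th (x * y) = th x * y + x * th y.
Hypothesis thC : forall c, th (iota c) = 0.
Variables (t : k) (Q1 Q2 : {poly K}).
Hypotheses (th_t : th t = t) (t_neq0 : t != 0).
Hypotheses (coprimeQ : coprimep Q1 Q2) (wronskQ_neq0 : wronsk Q1 Q2 != 0).
Notation "p ^i" := (map_poly iota p) (at level 2, format "p ^i").
Notation h := (Q1^i - t *: Q2^i).

(** A common root would be some [z] in [K], and [t = Q1(z) / Q2(z)] would be a constant, against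
    [th t = t]; if [Q2(z) = 0] then also [Q1(z) = 0], against coprimality. *)
Lemma curve_coprime_const (r : {poly K}) : r != 0 -> coprimep h r^i.
Proof.
move=> r0; have [rs rE] := closed_field_poly_normal r.
rewrite rE map_polyZ coprimepZr ?fmorph_eq0 ?lead_coef_eq0 // {rE}.
elim: rs => [|z rs IH]; first by rewrite big_nil rmorph1 coprimep1.
rewrite big_cons rmorphM coprimepMr {}IH andbT /=.
rewrite rmorphB /= map_polyX map_polyC coprimep_XsubC rootE !hornerE.
rewrite !horner_map /=; apply/negP; rewrite subr_eq0 => /eqP E.
have [Q2z|Q2z] := eqVneq Q2.[z] 0.
  have := coprimep_root (_ : coprimep Q2 Q1) (_ : root Q2 z).
  rewrite coprimep_sym => /(_ coprimeQ); rewrite rootE Q2z eqxx => /(_ isT).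
  by rewrite -(fmorph_eq0 iota) E Q2z rmorph0 mulr0 eqxx.
have tE : t = iota (Q1.[z] / Q2.[z]) by rewrite rmorphM fmorphV E mulfK ?fmorph_eq0.
by move: t_neq0; rewrite -th_t tE thC eqxx.
Qed.

Lemma deriv_curve : h^`() = (Q1^`())^i - t *: (Q2^`())^i.
Proof. by rewrite derivB derivZ !deriv_map. Qed.

(** The Wronskian equals [Q2 * h' - Q2' * h] and, having constant coefficients, is prime to [h]. *)
Lemma curve_separable : separable_poly h.
Proof.
have := curve_coprime_const wronskQ_neq0.
have -> : (wronsk Q1 Q2)^i = - (Q2^`())^i * h + Q2^i * h^`().
  rewrite deriv_curve /wronsk rmorphB !rmorphM /=.
  by rewrite -!mul_polyC; ring.
by rewrite coprimep_addl_mul coprimepMr unlock => /andP[].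
Qed.

(** The lift of [t d/dt] to the [y]-line is [(Q1 Q2 / W) d/dy], with [W] the Wronskian. With
    denominators cleared, this says that [th + (Q1 Q2 / W) d/dy] preserves the ideal of the
    curve. *)
Lemma curve_der :
  (wronsk Q1 Q2)^i * map_poly th h + (Q1 * Q2)^i * h^`() = (Q1^`() * Q2)^i * h.
Proof.
have -> : map_poly th h = - (t *: Q2^i).
  apply/polyP=> i; rewrite coef_map !coefB !coefZ !coef_map raddfB /=.
  by rewrite thM !thC th_t coefN coefZ coef_map; ring.
rewrite deriv_curve /wronsk !rmorphB !rmorphM /= -!mul_polyC.
by ring.
Qed.

(** Invariance passes to factors of a separable polynomial: modulo [F] the product rule leaves only
    the derivative of [F] times [G], and [G] is prime to [F]. *)
Lemma factor_der (F G : {poly k}) : h = F * G -> exists E,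
  (wronsk Q1 Q2)^i * map_poly th F + (Q1 * Q2)^i * F^`() = F * E.
Proof.
move=> hFG; have := curve_separable; rewrite hFG separable_mul => /and3P[_ _ FG].
suff /dvdpP[E ->] : F %| (wronsk Q1 Q2)^i * map_poly th F + (Q1 * Q2)^i * F^`().
  by exists E; rewrite mulrC.
rewrite -(Gauss_dvdpl _ FG).
have := curve_der; rewrite hFG (map_derM thM) derivM => E.
have -> : ((wronsk Q1 Q2)^i * map_poly th F + (Q1 * Q2)^i * F^`()) * G =
  F * ((Q1^`() * Q2)^i * G - (wronsk Q1 Q2)^i * map_poly th G - (Q1 * Q2)^i * G^`()).
  apply/eqP; rewrite -subr_eq0; apply/eqP; move/eqP: E; rewrite -subr_eq0 => /eqP<-.
  by ring.
exact: dvdp_mulr.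
Qed.

End FactorDerivation.

(** * Regularity at a point where the fibre of [Q] is unramified *)

Section LocalRegularity.
Variables (K : numClosedFieldType) (k : fieldType) (phi : {rmorphism {poly K} -> k}).
Variables (th : {additive k -> k}).
Hypothesis thM : forall x y, th (x * y) = th x * y + x * th y.
Hypothesis thC : forall c, th (phi c%:P) = 0.
Hypothesis phi_neq0 : forall a, a != 0 -> phi a != 0.
Variables (P1 P2 Q1 Q2 : {poly K}).
Let t := phi P1 / phi P2.
Hypotheses (th_t : th t = t) (t_neq0 : t != 0).
Hypotheses (coprimeQ : coprimep Q1 Q2) (Q2_neq0 : Q2 != 0)
  (sQ : (size Q2 < size Q1)%N).
Variables (F0 G0 : {poly {poly K}}).
Hypothesis FG0 : F0 * G0 = P2 *: Q1 ^:P - P1 *: Q2 ^:P.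
Hypothesis P2_neq0 : P2 != 0.
Hypothesis sF0 : (1 < size F0)%N.

Lemma size_curve : size (P2 *: Q1 ^:P - P1 *: Q2 ^:P) = size Q1.
Proof.
rewrite size_polyDl; first by rewrite size_scale // size_map_polyC.
rewrite size_polyN (size_scale _ P2_neq0) size_map_polyC.
by apply: leq_ltn_trans (size_scale_leq _ _) _; rewrite size_map_polyC.
Qed.

Lemma lead_coef_curve :
  lead_coef (P2 *: Q1 ^:P - P1 *: Q2 ^:P) = P2 * (lead_coef Q1)%:P.
Proof.
rewrite lead_coefDl ?lead_coefZ ?lead_coef_map_inj //; first exact: polyC_inj.
rewrite size_polyN (size_scale _ P2_neq0) size_map_polyC.
by apply: leq_ltn_trans (size_scale_leq _ _) _; rewrite size_map_polyC.
Qed.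

Lemma lead_coef_factor : lead_coef F0 * lead_coef G0 = P2 * (lead_coef Q1)%:P.
Proof. by rewrite -lead_coefM FG0 lead_coef_curve. Qed.

Let Q1_neq0 : Q1 != 0.
Proof. by rewrite -size_poly_gt0 (leq_trans _ sQ). Qed.

Let F0_neq0 : F0 != 0.
Proof. by rewrite -size_poly_gt0 ltnW. Qed.

Notation l := (lead_coef F0).
Definition monic_factor : {poly k} := (phi l)^-1 *: map_poly phi F0.
Notation F := monic_factor.

Let pl_neq0 : phi l != 0.
Proof. by rewrite phi_neq0 ?lead_coef_eq0. Qed.

Lemma monic_factor_monic : F \is monic.
Proof.
rewrite monicE lead_coefZ lead_coef_map_id0 ?rmorph0 //.
by rewrite mulVf.
Qed.

Lemma size_monic_factor : size F = size F0.
Proof. by rewrite size_scale ?invr_eq0 // size_map_poly_id0. Qed.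

Lemma monic_factor_dvd : exists G,
  map_poly (phi \o polyC) Q1 - t *: map_poly (phi \o polyC) Q2 = F * G.
Proof.
exists ((phi l / phi P2) *: map_poly phi G0).
have pP2 : phi P2 != 0 by rewrite phi_neq0.
rewrite /F -scalerAl -scalerAr scalerA mulrA mulVf // mul1r -rmorphM FG0.
rewrite rmorphB /= !map_polyZ /= scalerBr !scalerA mulVf // scale1r.
by rewrite mulrC -!map_poly_comp.
Qed.

Variables (O : subringClosed k) (x0 : K).
Hypothesis phiO : forall a, phi a \in O.
Hypothesis phiVO : forall a, a.[x0] != 0 -> (phi a)^-1 \in O.
Hypothesis P2x0 : P2.[x0] != 0.
Hypothesis separableQ : separable_poly (Q1 - (P1.[x0] / P2.[x0]) *: Q2).

Let lx0 : l.[x0] != 0.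
Proof.
have := congr1 (horner^~ x0) lead_coef_factor; rewrite /= !hornerE => E.
apply: contraNneq P2x0 => lx0; move/esym/eqP: E; rewrite lx0 mul0r mulf_eq0.
by rewrite lead_coef_eq0 (negPf Q1_neq0) orbF.
Qed.

Lemma monic_factor_polyOver : F \is a polyOver O.
Proof.
apply/polyOverP=> i; rewrite coefZ coef_map rpredM //; first exact: phiVO.
exact: phiO.
Qed.

(** Put [s = P(x0)]. At a root [z] of [Q1 - s Q2] the Wronskian is [Q2(z)] times the derivative of
    [Q1 - s Q2], so a common root would be a double point of the fibre. *)
Lemma wronsk_coprime_factor :
  coprimep (wronsk Q1 Q2) (map_poly (horner_eval x0) F0).
Proof.
apply: Pdiv.ClosedField.root_coprimep => z Wz; apply/negP=> /eqP Fz.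
have E : P2.[x0] * Q1.[z] - P1.[x0] * Q2.[z] = 0.
  have := congr1 (fun p => (map_poly (horner_eval x0) p).[z]) FG0.
  rewrite rmorphM hornerM Fz mul0r rmorphB /= !map_polyZ /=.
  rewrite -!map_poly_comp !map_poly_id //; last first.
  - by move=> c _; rewrite /= /horner_eval hornerC.
  - by move=> c _; rewrite /= /horner_eval hornerC.
  by rewrite !hornerE /horner_eval => <-.
pose s := P1.[x0] / P2.[x0].
have Qz : Q1.[z] = s * Q2.[z].
  by apply: (mulfI P2x0); rewrite /s mulrA mulrCA mulfV // mulr1; apply/eqP; rewrite -subr_eq0 E.
have Q2z : Q2.[z] != 0.
  apply/negP=> /eqP Q2z.
  have : root Q1 z by rewrite rootE Qz Q2z mulr0.
  by move/(coprimep_root coprimeQ); rewrite Q2z eqxx.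
have : root (Q1 - s *: Q2) z by rewrite rootE !hornerE Qz subrr.
have := separableQ; rewrite unlock => /coprimep_root/[apply].
rewrite derivB derivZ !hornerE => /negP; apply.
move: Wz; rewrite rootE /wronsk !hornerE Qz -mulrA [Q2.[z] * _]mulrC mulrA -mulrBl.
by rewrite mulf_eq0 (negPf Q2z) orbF.
Qed.

(** For [r] one takes the resultant in [y]: it specializes at [x0] to the resultant of two coprime
    polynomials. *)
Lemma local_bezout : exists r U V,
  r.[x0] != 0 /\ r%:P = U * (wronsk Q1 Q2) ^:P + V * F0.
Proof.
have W0 := w_neq0 Q2_neq0 sQ.
(* The Bezout form of the resultant asks for positive degrees, so a constant Wronskian is treated
   apart. *)
have [sW|sW] := leqP (size (wronsk Q1 Q2)) 1.
  have WE := size1_polyC sW.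
  exists ((wronsk Q1 Q2)`_0)%:P, 1, 0; rewrite mul0r addr0 mul1r hornerC; split.
    by apply: contraNneq W0 => W0; rewrite WE W0.
  by rewrite [in RHS]WE map_polyC.
have sW' : (1 < size (wronsk Q1 Q2) ^:P)%N by rewrite size_map_polyC.
have [[U V] /= _ E] := resultant_in_ideal sW' sF0.
exists (resultant (wronsk Q1 Q2) ^:P F0), U, V; split=> //.
rewrite -[_.[x0]]/(horner_eval x0 _) map_resultant //.
  rewrite -map_poly_comp map_poly_id; last first.
    by move=> c _; rewrite /= /horner_eval hornerC.
  by rewrite resultant_eq0 (eqP wronsk_coprime_factor).
rewrite lead_coef_map_inj //; last exact: polyC_inj.
by rewrite /= /horner_eval hornerC lead_coef_eq0.
Qed.

(** Multiplied by [U], the relation exhibits [r * H] as the remainder modulo the monic [F] of a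
    polynomial over [O], and [r] is a unit of [O]. *)
Lemma local_cofactor (H C : {poly k}) : (size H < size F)%N ->
  map_poly (phi \o polyC) (wronsk Q1 Q2) * H + F * C \is a polyOver O ->
  H \is a polyOver O.
Proof.
move=> sH HC; have [r [U [V [rx0 E]]]] := local_bezout.
have := congr1 (map_poly phi) E.
rewrite map_polyC rmorphD !rmorphM /= -map_poly_comp => {}E.
have mO (p : {poly {poly K}}) : map_poly phi p \is a polyOver O.
  by apply/polyOverP=> i; rewrite coef_map phiO.
have FE : map_poly phi F0 = phi l *: F by rewrite scalerA divff // scale1r.
have r0 : phi r != 0.
  by rewrite phi_neq0 //; apply: contraNneq rx0 => ->; rewrite horner0.
have [||_ rH] := @monic_polyOver k O F
   (map_poly phi U * C - phi l *: map_poly phi V * H) (phi r *: H)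
   monic_factor_monic monic_factor_polyOver.
- by rewrite size_scale.
- have -> : F * (map_poly phi U * C - phi l *: map_poly phi V * H) + phi r *: H =
      map_poly phi U * (map_poly (phi \o polyC) (wronsk Q1 Q2) * H + F * C).
    rewrite -[phi r *: H]mul_polyC E FE -!mul_polyC; ring.
  by rewrite rpredM.
have -> : H = (phi r)^-1 *: (phi r *: H) by rewrite scalerA mulVf // scale1r.
by rewrite polyOverZ // phiVO.
Qed.

Lemma monic_factor_regular i j : iter j th F`_i \in O.
Proof.
have [G hFG] := monic_factor_dvd.
have [E FE] := factor_der (iota := phi \o polyC) thM thC th_t t_neq0 coprimeQ
  (w_neq0 Q2_neq0 sQ) hFG.
have cO (p : {poly K}) : map_poly (phi \o polyC) p \is a polyOver O.
  by apply/polyOverP=> n; rewrite coef_map phiO.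
have c0 (p : {poly K}) : map_poly th (map_poly (phi \o polyC) p) = 0.
  by apply/polyP=> n; rewrite !coef_map coef0 /= thC.
apply: derclosed_iter.
apply: (polyOverP (derclosed_factor thM monic_factor_monic monic_factor_polyOver
  (cO _) (c0 _) (cO _) (c0 _) FE local_cofactor j)).
exact: thM.
Qed.

End LocalRegularity.

Lemma monic_factors_curve (K : numClosedFieldType) (k : fieldType)
    (phi : {rmorphism {poly K} -> k}) (P1 P2 Q1 Q2 : {poly K})
    (F0 G0 : {poly {poly K}}) :
  (forall a, a != 0 -> phi a != 0) -> (size Q2 < size Q1)%N ->
  F0 * G0 = P2 *: Q1 ^:P - P1 *: Q2 ^:P -> P2 != 0 ->
  phi (lead_coef Q1)%:P *: (monic_factor phi F0 * monic_factor phi G0) =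
    map_poly (phi \o polyC) Q1 - (phi P1 / phi P2) *: map_poly (phi \o polyC) Q2.
Proof.
move=> phi_neq0 sQ FG0 P20; have pP2 := phi_neq0 _ P20.
have lE := lead_coef_factor sQ FG0 P20.
have lF0 : phi (lead_coef F0) * phi (lead_coef G0) != 0.
  rewrite -rmorphM lE phi_neq0 // mulf_neq0 // polyC_eq0 lead_coef_eq0.
  by rewrite -size_poly_gt0 (leq_trans _ sQ).
have : map_poly phi F0 * map_poly phi G0 =
    phi P2 *: map_poly (phi \o polyC) Q1 - phi P1 *: map_poly (phi \o polyC) Q2.
  by rewrite -rmorphM FG0 rmorphB /= !map_polyZ -!map_poly_comp.
move=> E; rewrite /monic_factor -scalerAl -scalerAr E !scalerA scalerBr !scalerA.
have {lE} lE : phi (lead_coef Q1)%:P = phi (lead_coef F0) * phi (lead_coef G0) / phi P2.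
  by rewrite -rmorphM lE rmorphM mulrAC mulfV // mul1r.
rewrite lE; move: lF0; rewrite mulf_eq0 negb_or => /andP[l0 l0'].
rewrite -[X in _ = X - _]scale1r.
by congr (_ *: _ - _ *: _); field; rewrite ?l0 ?l0' ?pP2.
Qed.

Section Regular.
Variables (K : fieldType) (x0 : K).

Definition regular : {pred ratfun K} :=
  [pred f | `[< exists a b : {poly K}, b.[x0] != 0 /\ f = a%:F / b%:F >]].

Lemma horner_neq0 (b : {poly K}) : b.[x0] != 0 -> b != 0.
Proof. by apply: contraNneq => ->; rewrite horner0. Qed.

Lemma regularP f :
  reflect (exists a b : {poly K}, b.[x0] != 0 /\ f = a%:F / b%:F) (f \in regular).
Proof. exact: asboolP. Qed.

Lemma regular_subring : subring_closed regular.
Proof.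
have hM (b d : {poly K}) : b.[x0] != 0 -> d.[x0] != 0 -> (b * d).[x0] != 0.
  by move=> b0 d0; rewrite hornerM mulf_neq0.
split=> [|f g /regularP[a [b [b0 ->]]] /regularP[c [d [d0 ->]]]
         |f g /regularP[a [b [b0 ->]]] /regularP[c [d [d0 ->]]]]; apply/regularP.
- by exists 1, 1; rewrite hornerC oner_neq0 tofrac1 divr1.
- exists (a * d - c * b), (b * d); split; first exact: hM.
  have b0' : b%:F != 0 by rewrite tofrac_eq0 horner_neq0.
  have d0' : d%:F != 0 by rewrite tofrac_eq0 horner_neq0.
  by rewrite (subf_div _ _ b0' d0') tofracB !tofracM.
- exists (a * c), (b * d); split; first exact: hM.
  by rewrite mulf_div !tofracM.
Qed.

HB.instance Definition _ :=
  GRing.isSubringClosed.Build (ratfun K) regular regular_subring.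

Lemma regular_tofrac a : a%:F \in regular.
Proof. by apply/regularP; exists a, 1; rewrite hornerC oner_neq0 tofrac1 divr1. Qed.

Lemma regular_tofracV a : a.[x0] != 0 -> a%:F^-1 \in regular.
Proof. by move=> a0; apply/regularP; exists 1, a; rewrite tofrac1 div1r. Qed.

End Regular.

(** * Bounding the poles and degrees of the orbit *)

Section LocalDivisibility.
Variable K : numClosedFieldType.
Implicit Types p q n b : {poly K}.

Lemma dvdp_local n b : b != 0 ->
  (forall x, root b x -> exists p q, q.[x] != 0 /\ n * q = p * b) -> b %| n.
Proof.
move=> b0 loc; set g := gcdp b n.
have g0 : g != 0 by rewrite gcdp_eq0 negb_and b0.
have bE : b = b %/ g * g by rewrite divpK ?dvdp_gcdl.
have nE : n = n %/ g * g by rewrite divpK ?dvdp_gcdr.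
have cop : coprimep (b %/ g) (n %/ g) by rewrite coprimep_div_gcd ?b0.
have [s1|/closed_rootP[x rx]] := eqVneq (size (b %/ g)) 1.
  have := size_poly_eq1 (b %/ g); rewrite s1 eqxx => /esym/eqp_dvdl.
  move=> H; rewrite bE nE dvdp_mul2r // H dvd1p //.
have [|p [q [qx E]]] := loc x; first by rewrite bE rootM rx.
have {}E : n %/ g * q = p * (b %/ g).
  by apply: (mulIf g0); rewrite -[RHS]mulrA -bE -E [in RHS]nE mulrAC.
have := congr1 (horner^~ x) E; rewrite /= !hornerM (eqP rx) mulr0 => /eqP.
by rewrite mulf_eq0 (negPf qx) orbF (negPf (coprimep_root cop rx)).
Qed.

(** Here [r / s] stands for [p / p'], which vanishes at each root of [p] because in characteristic 0
    the multiplicity drops by exactly one in [p']. *)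
Lemma root_radical p r s x : p != 0 -> p * s = p^`() * r ->
  root p x -> root r x.
Proof.
move=> p0 E px; have [m [c]] := multiplicity_XsubC p x; rewrite p0 /= => cx pE.
case: m pE => [|m] pE; first by move: px; rewrite pE expr0 mulr1 (negPf cx).
have X0 : ('X - x%:P) ^+ m != 0 by rewrite expf_neq0 // polyXsubC_eq0.
have {}E : c * ('X - x%:P) * s = (c^`() * ('X - x%:P) + c *+ m.+1) * r.
  have aux (R : comPzRingType) (c' d X A s' r' : R) M :
      c' * (X * A) * s' = (d * (X * A) + c' * (A *+ M)) * r' ->
      c' * X * s' * A = (d * X + c' *+ M) * r' * A.
    move=> H; transitivity (c' * (X * A) * s'); first by ring.
    by rewrite H mulrnAr -mulrnAl; ring.
  apply: (mulIf X0); apply: aux; move: E.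
  by rewrite pE derivM deriv_exp derivXsubC exprS /= mul1r.
have := congr1 (horner^~ x) E; rewrite /= !hornerE subrr !(mulr0, mul0r) add0r.
rewrite hornerMn => /esym/eqP; rewrite mulf_eq0 mulrn_eq0 /=.
by move: cx; rewrite !rootE => /negPf->.
Qed.

End LocalDivisibility.

Section Bounded.
Variables (K : numClosedFieldType) (P1 P2 : {poly K}).
Hypotheses (P2_neq0 : P2 != 0) (sP : (size P2 < size P1)%N).
Hypothesis coprimeP : coprimep P1 P2.
Notation k := (ratfun K).
Notation w := (wronsk P1 P2).

Definition over_P2 (a : {poly K}) : k := a%:F / P2%:F.

Lemma over_P2_is_zmod_morphism : zmod_morphism over_P2.
Proof. by move=> a b; rewrite /over_P2 tofracB mulrBl. Qed.

HB.instance Definition _ :=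
  GRing.isZmodMorphism.Build {poly K} k over_P2 over_P2_is_zmod_morphism.

Lemma over_P2Z c a : over_P2 (c *: a) = cst K c * over_P2 a.
Proof. by rewrite /over_P2 -mul_polyC tofracM -mulrA. Qed.

(* Away from the double roots of [P1 - s P2], [s != 0], the derivation [theta]
   has no poles, and it is logarithmic over [0] and infinity. *)
Lemma theta_over_P2 N (a : {poly K}) : (0 < N)%N -> (size a <= N)%N ->
  (forall x, P2.[x] != 0 -> P1.[x] != 0 -> root w x ->
     theta P1 P2 (over_P2 a) \in regular x) ->
  exists2 b : {poly K}, (size b <= N)%N & theta P1 P2 (over_P2 a) = over_P2 b.
Proof.
move=> N0 sa loc; have P10 := P1_neq0 sP.
pose g1 := gcdp P1 P1^`(); pose r1 := P1 %/ g1; pose s1 := P1^`() %/ g1.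
pose g2 := gcdp P2 P2^`(); pose r2 := P2 %/ g2; pose s2 := P2^`() %/ g2.
have P1E : P1 = r1 * g1 by rewrite divpK ?dvdp_gcdl.
have P1'E : P1^`() = s1 * g1 by rewrite divpK ?dvdp_gcdr.
have P2E : P2 = r2 * g2 by rewrite divpK ?dvdp_gcdl.
have P2'E : P2^`() = s2 * g2 by rewrite divpK ?dvdp_gcdr.
have cop1 : coprimep r1 s1 by rewrite coprimep_div_gcd ?P10.
have cop2 : coprimep r2 s2 by rewrite coprimep_div_gcd ?P2_neq0.
have g10 : g1 != 0 by rewrite gcdp_eq0 negb_and P10.
have g20 : g2 != 0 by rewrite gcdp_eq0 negb_and P2_neq0.
clearbody r1 s1 r2 s2; clearbody g1 g2.
(* Removing [g1] and [g2] from [w] removes its zeros over 0 and infinity. The roots of [B] lie over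
   other values, where [loc] applies. *)
pose B := s1 * r2 - r1 * s2.
have wE : w = g1 * g2 * B.
  by rewrite /wronsk P1'E P2'E P2E P1E /B; ring.
have w0 := w_neq0 P2_neq0 sP.
have B0 : B != 0 by apply: contraNneq w0 => B0; rewrite wE B0 mulr0.
pose n := r1 * (a^`() * r2 - a * s2).
have nE : g1 * g2 * n = P1 * wronsk a P2.
  by rewrite /n /wronsk P2'E P2E P1E; ring.
have E1 x : root r1 x -> root P1 x by move=> r; rewrite P1E rootM r.
have E2 x : root r2 x -> root P2 x by move=> r; rewrite P2E rootM r.
have no12 x : root P1 x -> root P2 x -> False.
  by move=> /(coprimep_root coprimeP) H; rewrite rootE (negPf H).
have [b nB] : exists b, n = b * B.
  apply/dvdpP/dvdp_local => // x Bx.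
  have Bx' : s1.[x] * r2.[x] = r1.[x] * s2.[x].
    by move: Bx; rewrite rootE /B !hornerE subr_eq0 => /eqP.
  have P2x : P2.[x] != 0.
    apply/negP=> P2x; have r2x : root r2 x.
      apply: (@root_radical _ P2 r2 s2) => //.
      by rewrite P2'E P2E; ring.
    apply: (no12 x) => //; apply: E1; move: Bx'; rewrite (eqP r2x) mulr0.
    move/esym/eqP; rewrite mulf_eq0 => /orP[//|].
    by rewrite (negPf (coprimep_root cop2 r2x)).
  have P1x : P1.[x] != 0.
    apply/negP=> P1x; have r1x : root r1 x.
      apply: (@root_radical _ P1 r1 s1) => //.
      by rewrite P1'E P1E; ring.
    case/negP: P2x; rewrite -rootE; apply: E2; move: Bx'; rewrite (eqP r1x) mul0r.
    move/eqP; rewrite mulf_eq0 => /orP[|//].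
    by rewrite (negPf (coprimep_root cop1 r1x)).
  have wx : root w x by rewrite wE rootM Bx orbT.
  have /regularP[p [q [qx]]] := loc x P2x P1x wx.
  rewrite theta_fracE // => /tofrac_cross E.
  exists (p * P2), q; split=> //.
  have {}E := E (mulf_neq0 w0 (expf_neq0 _ P2_neq0)) (horner_neq0 qx).
  apply: (mulfI (mulf_neq0 (mulf_neq0 g10 g20) P2_neq0)).
  transitivity (P1 * P2 * wronsk a P2 * q); last by rewrite E wE; ring.
  by rewrite -mulrA [P1 * P2]mulrC -[X in _ = X * q]mulrA -nE; ring.
have wb : w * b = P1 * wronsk a P2 by rewrite -nE nB wE; ring.
(* A degree count: [theta] is also logarithmic at infinity. For [a = 0] the count only bounds the
   size of [b] by 1, whence [0 < N]. *)
exists b.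
  have [->|b0] := eqVneq b 0; first by rewrite size_poly0.
  have : (size ('X * w * b)%R <= (size P1).-1 + ((size a).-1 + (size P2).-1).+1)%N.
    rewrite -mulrA wb mulrCA addnS.
    by rewrite sizeM_top ?sizeX_wronsk ?leqSpred.
  rewrite size_mul ?(size_w P2_neq0 sP) //; last by rewrite mulf_neq0 ?polyX_eq0.
  rewrite addSn /= -addnA leq_add2l addnC -addSn leq_add2r => H.
  apply: leq_trans H _; case: (size a) sa => //.
rewrite /over_P2 theta_fracE //.
have -> : P1 * P2 * wronsk a P2 = b * (w * P2) by rewrite mulrAC -wb; ring.
have -> : w * P2 ^+ 2 = P2 * (w * P2) by ring.
have wP : (w * P2)%:F != 0 :> k by rewrite tofrac_neq0 // mulf_neq0.
by rewrite (tofracM b) (tofracM P2 (w * P2)) -mulf_div (divff wP) mulr1.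
Qed.

End Bounded.

Section FactorEigensum.
Variables (K : numClosedFieldType) (P1 P2 Q1 Q2 : {poly K}).
Hypotheses (P2_neq0 : P2 != 0) (sP : (size P2 < size P1)%N).
Hypotheses (Q2_neq0 : Q2 != 0) (sQ : (size Q2 < size Q1)%N).
Hypotheses (coprimeP : coprimep P1 P2) (coprimeQ : coprimep Q1 Q2).
Hypothesis no_common_double_root : forall s, s != 0 ->
  separable_poly (P1 - s *: P2) || separable_poly (Q1 - s *: Q2).
Notation k := (ratfun K).

Let phi : {rmorphism {poly K} -> k} := @tofrac {poly K}.

(** The zero [x] of the Wronskian is a double root of [P1 - s P2], so the other alternative of the
    hypothesis must hold. *)
Lemma separable_fiber x : P2.[x] != 0 -> P1.[x] != 0 -> root (wronsk P1 P2) x ->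
  separable_poly (Q1 - (P1.[x] / P2.[x]) *: Q2).
Proof.
move=> P2x P1x wx; set s := P1.[x] / P2.[x].
have s0 : s != 0 by rewrite mulf_neq0 ?invr_eq0.
have /orP[|//] := no_common_double_root s0.
have sE : P1.[x] = s * P2.[x] by rewrite divfK.
have r : root (P1 - s *: P2) x by rewrite rootE !hornerE -sE subrr.
rewrite unlock => /coprimep_root/(_ r)/negP[].
move: wx; rewrite rootE /wronsk derivB derivZ !hornerE sE.
rewrite -mulrA [P2.[x] * _]mulrC mulrA -mulrBl mulf_eq0.
by rewrite (negPf P2x) orbF.
Qed.

Lemma monic_factor_eigensum (F0 G0 : {poly {poly K}}) i :
  F0 * G0 = P2 *: Q1 ^:P - P1 *: Q2 ^:P -> (1 < size F0)%N ->
  eigensum (theta P1 P2) (cst K) (monic_factor phi F0)`_i.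
Proof.
move=> FG0 sF0.
have phi_neq0 (a : {poly K}) : a != 0 -> phi a != 0 by rewrite tofrac_eq0.
have th_t := theta_t P2_neq0 sP.
have t_neq0 : phi P1 / phi P2 != 0.
  by rewrite mulf_neq0 ?invr_eq0 ?phi_neq0 ?(P1_neq0 sP).
have lQ : lead_coef Q1 != 0.
  by rewrite lead_coef_eq0 -size_poly_gt0 (leq_trans _ sQ).
have lE := lead_coef_factor sQ FG0 P2_neq0.
have l0 : lead_coef F0 != 0 by rewrite lead_coef_eq0 -size_poly_gt0 ltnW.
(* The leading coefficients of [F0] and [G0] multiply to a constant times [P2], so [P2] is a
   denominator for every coefficient of the monic factor. *)
pose a0 := (lead_coef Q1)^-1 *: (F0`_i * lead_coef G0).
have iE : (monic_factor phi F0)`_i = over_P2 P2 a0.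
  rewrite /monic_factor coefZ coef_map.
  have E : F0`_i * P2 = a0 * lead_coef F0.
    have -> : P2 = (lead_coef Q1)^-1 *: (lead_coef F0 * lead_coef G0).
      by rewrite lE mulrC mul_polyC scalerA mulVf // scale1r.
    by rewrite /a0 -scalerAl -scalerAr -mulrA [lead_coef G0 * _]mulrC.
  rewrite mulrC; exact: (tofrac_div_eq l0 P2_neq0 E).
rewrite iE; pose N := (size a0).+1.
apply: (@bounded_orbit_eigensum K k (theta P1 P2) (cst K) (@thetaM K P1 P2)
  (theta_cst P1 P2) (theta_no_jordan P2_neq0 sP) (over_P2 P2) N _ (over_P2Z P2)).
elim=> [|j [a sa jE]]; first by exists a0.
rewrite iterS jE; apply: (theta_over_P2 P2_neq0 sP coprimeP _ sa) => // x P2x P1x wx.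
rewrite -jE -iterS -iE.
apply: (@monic_factor_regular K k phi (theta P1 P2) (@thetaM K P1 P2)
  (theta_cst P1 P2) phi_neq0 P1 P2 Q1 Q2 th_t t_neq0 coprimeQ Q2_neq0 sQ F0 G0 FG0
  P2_neq0 sF0 (regular x) x).
- by move=> a1; apply: regular_tofrac.
- by move=> a1; apply: regular_tofracV.
- exact: P2x.
- exact: separable_fiber.
Qed.

End FactorEigensum.

(** * Reduction to Kummer's equation *)

Section Laurent.
Variables (K : numClosedFieldType) (k : fieldType).
Variables (iota : {rmorphism K -> k}) (u : k).
Hypotheses (u_neq0 : u != 0) (u_nonconst : forall c, u != iota c).

Definition eval_at : {rmorphism {poly K} -> k} := horner_eval u \o map_poly iota.

Lemma eval_atX n : eval_at 'X^n = u ^+ n.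
Proof. by rewrite /eval_at /= /horner_eval rmorphXn /= map_polyX hornerXn. Qed.

Lemma eval_atC c : eval_at c%:P = iota c.
Proof. by rewrite /eval_at /= /horner_eval map_polyC hornerC. Qed.

(** Over an algebraically closed [K] a nonconstant [u] is transcendental: a relation would split
    into factors [u - z]. *)
Lemma eval_at_eq0 p : (eval_at p == 0) = (p == 0).
Proof.
apply/idP/eqP=> [|->]; last by rewrite rmorph0.
have [r pE] := closed_field_poly_normal p; rewrite {1}pE -mul_polyC (rmorphM eval_at).
rewrite eval_atC mulf_eq0 fmorph_eq0 lead_coef_eq0 => /orP[/eqP//|].
rewrite (rmorph_prod eval_at) prodf_seq_eq0 => /hasP[z _].
by rewrite andTb (rmorphB eval_at) -['X]expr1 eval_atX eval_atC subr_eq0 (negPf (u_nonconst z)).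
Qed.

Lemma eval_at_inj : injective eval_at.
Proof.
by move=> p q /eqP; rewrite -subr_eq0 -(rmorphB eval_at) eval_at_eq0 subr_eq0 => /eqP.
Qed.

Definition laurent (f : k) := exists N p, u ^+ N * f = eval_at p.

Lemma laurentD f g : laurent f -> laurent g -> laurent (f + g).
Proof.
move=> [N [p fp]] [M [q gq]]; exists (N + M)%N, ('X^M * p + 'X^N * q).
by rewrite (rmorphD eval_at) !(rmorphM eval_at) !eval_atX -fp -gq exprD; ring.
Qed.

Lemma laurent_monomial b (j : int) : laurent (iota b * u ^ j).
Proof.
case: j => n; first by exists 0%N, (b%:P * 'X^n); rewrite (rmorphM eval_at) eval_atX eval_atC mul1r.
exists n.+1, b%:P; rewrite eval_atC NegzE -exprnN mulrCA mulfV ?mulr1 //.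
exact: expf_neq0.
Qed.

Lemma laurent_sum (I : eqType) (s : seq I) (F : I -> k) :
  (forall i, i \in s -> laurent (F i)) -> laurent (\sum_(i <- s) F i).
Proof.
move=> sL; rewrite big_seq; elim/big_rec: _ => [|i f /sL]; last exact: laurentD.
by exists 0%N, 0; rewrite rmorph0 mulr0.
Qed.

Lemma laurent_poly (F : {poly k}) : F != 0 -> (forall i, laurent F`_i) ->
  exists N (A : {poly {poly K}}),
    size A = size F /\ map_poly eval_at A = u ^+ N *: F.
Proof.
move=> F0 FL.
have [N NE] : exists N, forall i, (i < size F)%N -> exists p, u ^+ N * F`_i = eval_at p.
  elim: (size F) => [|n [N NE]]; first by exists 0%N.
  have [M [q qE]] := FL n; exists (N + M)%N => i.
  rewrite ltnS leq_eqVlt => /orP[/eqP->|/NE[p pE]].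
    by exists ('X^N * q); rewrite (rmorphM eval_at) eval_atX -qE exprD mulrA.
  by exists ('X^M * p); rewrite (rmorphM eval_at) eval_atX -pE exprD; ring.
have {}NE i : exists p, u ^+ N * F`_i = eval_at p.
  case: (ltnP i (size F)) => [/NE//|si].
  by exists 0; rewrite nth_default // mulr0 rmorph0.
pose c i := projT1 (cid (NE i)).
have cE i : u ^+ N * F`_i = eval_at (c i) by rewrite /c; case: cid.
exists N, (\poly_(i < size F) c i); split.
  apply: size_poly_eq; rewrite -eval_at_eq0 -cE.
  by rewrite mulf_neq0 ?expf_neq0 // -lead_coefE lead_coef_eq0.
apply/polyP=> i; rewrite coef_map coef_poly coefZ cE.
by case: ltnP => // si; rewrite -cE (nth_default _ si) mulr0; apply: rmorph0.
Qed.

(** As substituting [u] is injective, a factorization over [k] with Laurent coefficients can be read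
    with an indeterminate in place of [u]. *)
Lemma laurent_factor (F G : {poly k}) c (Q1 Q2 : {poly K}) m N M
    (A B : {poly {poly K}}) :
  map_poly eval_at A = u ^+ N *: F -> map_poly eval_at B = u ^+ M *: G ->
  iota c *: (F * G) = map_poly iota Q1 - u ^+ m *: map_poly iota Q2 ->
  (c%:P *: A) * B = 'X^(N + M) *: (Q1 ^:P - 'X^m *: Q2 ^:P).
Proof.
move=> AE BE FG; have mC (Q : {poly K}) : map_poly eval_at (Q ^:P) = map_poly iota Q.
  by apply/polyP=> i; rewrite !coef_map; apply: eval_atC.
apply: (map_inj_poly eval_at_inj); first exact: rmorph0.
transitivity (map_poly eval_at (c%:P *: A) * map_poly eval_at B).
  exact: rmorphM.
rewrite !(map_polyZ eval_at) AE BE.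
have -> : map_poly eval_at (Q1 ^:P - 'X^m *: Q2 ^:P) =
    map_poly eval_at (Q1 ^:P) - map_poly eval_at ('X^m *: Q2 ^:P) by exact: raddfB.
rewrite (map_polyZ eval_at) !mC.
rewrite !eval_atX eval_atC -FG -!scalerAl -scalerAr !scalerA exprD.
by congr (_ *: _); ring.
Qed.

End Laurent.

Section CancelX.
Variable K : fieldType.
Implicit Types A B h : {poly {poly K}}.

Lemma scale_polyI (c : {poly K}) : c != 0 -> injective (fun h => c *: h).
Proof.
move=> c0 p q /=; rewrite -!mul_polyC; apply: mulfI.
by rewrite polyC_eq0.
Qed.

Lemma divX_factor A : map_poly (horner_eval 0) A = 0 ->
  exists2 A' : {poly {poly K}}, size A' = size A & A = 'X *: A'.
Proof.
move=> A0; have rt i : root A`_i 0.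
  rewrite rootE; apply/eqP.
  by have := congr1 (fun p : {poly K} => p`_i) A0; rewrite coef_map coef0.
have dX i : A`_i = A`_i %/ 'X * 'X.
  by rewrite divpK // -['X]subr0 -polyC0 dvdp_XsubCl.
exists (\poly_(i < size A) (A`_i %/ 'X)); last first.
  apply/polyP=> i; rewrite coefZ coef_poly mulrC.
  by case: ltnP => si; [rewrite -dX | rewrite nth_default // mul0r].
have [->|nA] := eqVneq A 0; first by apply/eqP; rewrite size_poly0 -leqn0 size_poly.
apply: size_poly_eq; apply: contraNneq nA => q0.
by rewrite -lead_coef_eq0 lead_coefE dX q0 mul0r.
Qed.

(** The inner variable ['X] is prime: setting it to 0 kills the product, hence one factor. Each ['X]
    is thus removed from [A] or from [B], with the outer degrees unchanged. *)
Lemma cancelX n A B h : A * B = 'X^n *: h ->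
  exists A' B' : {poly {poly K}},
    [/\ size A' = size A, size B' = size B & A' * B' = h].
Proof.
elim: n A B => [|n IH] A B E; first by exists A, B; rewrite E scale1r.
have X0 : 'X != 0 :> {poly K} by rewrite polyX_eq0.
have /eqP : map_poly (horner_eval 0) (A * B) = 0.
  apply/polyP=> i; rewrite E coef_map coef0 coefZ /= /horner_eval.
  by rewrite hornerM hornerXn expr0n mul0r.
rewrite rmorphM mulf_eq0 => /orP[] /eqP/divX_factor[C sC CE].
  have [|A' [B' [sA sB E']]] := IH C B.
    by apply: (scale_polyI X0); rewrite scalerAl -CE E exprS scalerA.
  by exists A', B'; rewrite sA sC.
have [|A' [B' [sA sB E']]] := IH A C.
  by apply: (scale_polyI X0); rewrite scalerAr -CE E exprS scalerA.
by exists A', B'; rewrite sB sC.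
Qed.

End CancelX.

(** * Norms and powers for binomial equations *)

Section Kummer.
Variable L : fieldType.

Lemma det_exp n (M : 'M[L]_n.+1) m : \det (M ^+ m) = \det M ^+ m.
Proof.
elim: m => [|m IH]; first by rewrite !expr0 det1.
by rewrite !exprS -IH -det_mulmx.
Qed.

(* [c] is the determinant of multiplication by ['X] modulo [A], made monic. *)
Lemma dvd_binomial_norm (A : {poly L}) (a : L) m :
  A != 0 -> A %| 'X^m - a%:P -> exists c, c ^+ m = a ^+ (size A).-1.
Proof.
move=> A0; pose A1 := (lead_coef A)^-1 *: A.
have l0 : (lead_coef A)^-1 != 0 by rewrite invr_eq0 lead_coef_eq0.
have mA : A1 \is monic by rewrite monicE lead_coefZ mulVf ?lead_coef_eq0.
rewrite -(dvdpZl _ _ l0) -/A1 -(size_scale A l0) -/A1.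
have : exists M : 'M[L]_((size A1).-1), char_poly M = A1 :> {poly L}.
  by exists (companionmx (A1 : {poly L})); exact: companionmxK.
case: (size A1).-1 => [|n] [M ME]; first by exists 1; rewrite expr1n expr0.
case/dvdpP=> q E; exists (\det M).
have := congr1 (horner_mx M) E.
rewrite rmorphM /= -ME Cayley_Hamilton mulr0 rmorphB rmorphXn /= horner_mx_X.
rewrite horner_mx_C => /eqP; rewrite subr_eq0 => /eqP MX.
by rewrite -det_exp MX det_scalar.
Qed.

End Kummer.

Section Core.
Variable K : numClosedFieldType.

Lemma root_of_unity_const (L : fieldType) (iota : {rmorphism K -> L}) z g :
  (0 < g)%N -> z ^+ g = 1 -> exists c, z = iota c.
Proof.
move=> g0 zg; have [r rE] := closed_field_poly_normal ('X^g - 1 : {poly K}).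
have l1 : lead_coef ('X^g - 1 : {poly K}) = 1.
  by rewrite -[1]/(1%:P) lead_coefXnsubC.
have := congr1 (fun p => (map_poly iota p).[z]) rE; rewrite /= l1 scale1r.
rewrite rmorphB rmorph1 rmorphXn /= map_polyX !hornerE zg subrr.
rewrite rmorph_prod horner_prod => /esym/eqP; rewrite prodf_seq_eq0.
case/hasP=> c _ /=; rewrite rmorphB /= map_polyX map_polyC !hornerE subr_eq0.
by move/eqP=> zc; exists c.
Qed.

(** With [g = gcd(j, m) = a j - b m], the element [e = c ^ a / q ^ b] satisfies [e ^ m = q ^ g]. So
    [q] and [e ^ d] differ by a root of unity, which is a constant and has a [d]-th root. *)
Lemma power_of_norm (L : fieldType) (iota : {rmorphism K -> L}) (q c : L) m j :
  q != 0 -> (0 < j < m)%N -> c ^+ m = q ^+ j ->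
  exists d e S, [/\ (1 < d)%N, m = (e * d)%N & q = S ^+ d].
Proof.
move=> q0 /andP[j0 jm] cq; have m0 : (0 < m)%N by apply: leq_trans jm.
pose g := gcdn j m; have g0 : (0 < g)%N by rewrite gcdn_gt0 j0.
have mE : m = (g * (m %/ g))%N by rewrite mulnC divnK ?dvdn_gcdr.
set d := (m %/ g)%N in mE.
have d1 : (1 < d)%N.
  rewrite ltn_divRL ?dvdn_gcdr // mul1n; apply: leq_ltn_trans jm.
  by apply: dvdn_leq; rewrite ?dvdn_gcdl.
case: (egcdnP m j0) => a b ab _.
have c0 : c != 0.
  apply: contraNneq q0 => c0; move/eqP: cq.
  by rewrite c0 expr0n gtn_eqF // eq_sym expf_eq0 => /andP[].
pose e := c ^+ a / q ^+ b.
have eE : (q / e ^+ d) ^+ g = 1.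
  rewrite expr_div_n -exprM mulnC -mE /e expr_div_n -!exprM.
  rewrite [(a * m)%N]mulnC exprM cq -exprM [(j * a)%N]mulnC ab exprD -/g.
  have qb : q ^+ (b * m) != 0 by rewrite expf_neq0.
  have qg : q ^+ g != 0 by rewrite expf_neq0.
  by rewrite [_ * q ^+ g]mulrC mulfK // mulfV.
have [z zE] := root_of_unity_const iota g0 eE.
exists d, g, (iota (d.-root z) * e); split=> //.
rewrite exprMn -rmorphXn rootCK; last exact: ltnW.
by rewrite -zE divfK // expf_neq0 // mulf_neq0 ?invr_eq0 // expf_neq0.
Qed.

End Core.

Section SwapFactor.
Variables (K : fieldType) (Q1 Q2 : {poly K}) (m : nat).
Hypotheses (Q2_neq0 : Q2 != 0) (coprimeQ : coprimep Q1 Q2) (m_gt0 : (0 < m)%N).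
Implicit Types A B : {poly {poly K}}.

Lemma swapXY_kummer : swapXY (Q1 ^:P - 'X^m *: Q2 ^:P) = Q1%:P - 'X^m * Q2%:P.
Proof.
have E2 : swapXY ('X^m *: Q2 ^:P) = 'X^m * Q2%:P.
  have := swapXY_is_scalable 'X^m (Q2 ^:P).
  by rewrite /= (swapXY_map_polyC Q2) (map_polyXn _ m).
transitivity (swapXY Q1 ^:P - swapXY ('X^m *: Q2 ^:P)); first exact: raddfB.
by rewrite E2 (swapXY_map_polyC Q1).
Qed.

(** A factor free of ['X] would divide both [Q1] and [Q2], the coefficients in degrees 0 and [m] up
    to sign, and so be a unit. *)
Lemma size_swap_factor A B : A * B = Q1 ^:P - 'X^m *: Q2 ^:P ->
  (1 < size A)%N -> (1 < size (swapXY A))%N.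
Proof.
move=> /(congr1 swapXY); rewrite swapXY_kummer rmorphM /= => E sA.
rewrite ltnNge; apply/negP => sS; have aE := size1_polyC sS.
set a := (swapXY A)`_0 in aE; set C := swapXY B in E; rewrite aE mul_polyC in E.
have a1 : a %| Q1.
  apply/dvdpP; exists C`_0; have := congr1 (fun p : {poly {poly K}} => p`_0) E.
  by rewrite coefZ coefB coefC /= coefXnM m_gt0 subr0 mulrC.
have a2 : a %| Q2.
  apply/dvdpP; exists (- C`_m); have := congr1 (fun p : {poly {poly K}} => p`_m) E.
  rewrite coefZ coefB coefC (gtn_eqF m_gt0) coefXnM ltnn subnn coefC eqxx sub0r.
  by rewrite mulNr mulrC => ->; rewrite opprK.
have a_unit : size a = 1%N.
  apply/eqP; rewrite -dvdp1; have : a %| gcdp Q1 Q2 by rewrite dvdp_gcd a1.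
  by move: coprimeQ; rewrite -gcdp_eqp1 => /eqp_dvdr->.
move: sA; rewrite -(swapXYK A) aE swapXY_polyC.
by rewrite size_map_polyC a_unit.
Qed.

Lemma norm_of_factor (L : fieldType) (psi : {rmorphism {poly K} -> L}) A B :
  (forall a, a != 0 -> psi a != 0) -> A * B = Q1 ^:P - 'X^m *: Q2 ^:P ->
  exists c, c ^+ m = (psi Q1 / psi Q2) ^+ (size (swapXY A)).-1.
Proof.
move=> psi_neq0 /(congr1 swapXY); rewrite swapXY_kummer rmorphM /= => E.
have A0 : swapXY A != 0.
  apply: contraNneq Q2_neq0 => A0; move: E; rewrite A0 mul0r.
  move=> /(congr1 (fun p : {poly {poly K}} => p`_m)).
  rewrite coef0 coefB coefC (gtn_eqF m_gt0) coefXnM ltnn subnn coefC eqxx sub0r.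
  by move/esym/eqP; rewrite oppr_eq0.
have lA0 : psi (lead_coef (swapXY A)) != 0 by rewrite psi_neq0 ?lead_coef_eq0.
have <- : size (map_poly psi (swapXY A)) = size (swapXY A) by rewrite size_map_poly_id0.
apply: dvd_binomial_norm.
  by rewrite -size_poly_gt0 size_map_poly_id0 // size_poly_gt0.
apply/dvdpP; exists (- (psi Q2)^-1 *: map_poly psi (swapXY B)).
have q0 : psi Q2 != 0 by rewrite psi_neq0.
have {}E : map_poly psi (swapXY A) * map_poly psi (swapXY B) =
    (psi Q1)%:P - 'X^m * (psi Q2)%:P.
  rewrite -(map_polyC psi) -(map_polyC psi) -(map_polyXn psi m).
  rewrite -(rmorphM (map_poly psi)) -(rmorphM (map_poly psi)).
  by rewrite E -(rmorphB (map_poly psi)).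
rewrite -scalerAl [map_poly psi (swapXY B) * _]mulrC E -mul_polyC mulrBr.
have -> : (- (psi Q2)^-1)%:P * ('X^m * (psi Q2)%:P) = - 'X^m.
  by rewrite mulrCA -polyCM mulNr mulVf // polyCN mulrN mulr1.
by rewrite -polyCM opprK mulNr polyCN addrC mulrC.
Qed.

End SwapFactor.

(** * Reducible curves with the common critical values at 0 and infinity *)

Section CoreTheorem.
Variables (K : numClosedFieldType) (P1 P2 Q1 Q2 : {poly K}).
Hypotheses (P2_neq0 : P2 != 0) (sP : (size P2 < size P1)%N).
Hypotheses (Q2_neq0 : Q2 != 0) (sQ : (size Q2 < size Q1)%N).
Hypotheses (coprimeP : coprimep P1 P2) (coprimeQ : coprimep Q1 Q2).
Hypothesis no_common_double_root : forall s, s != 0 ->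
  separable_poly (P1 - s *: P2) || separable_poly (Q1 - s *: Q2).
Variables F0 G0 : {poly {poly K}}.
Hypotheses (sF0 : (1 < size F0)%N) (sG0 : (1 < size G0)%N).
Hypothesis FG0 : F0 * G0 = P2 *: Q1 ^:P - P1 *: Q2 ^:P.
Notation k := (ratfun K).
Notation t := (P1%:F / P2%:F : k).

Let phi : {rmorphism {poly K} -> k} := @tofrac {poly K}.

Let phi_neq0 (a : {poly K}) : a != 0 -> phi a != 0.
Proof. by rewrite tofrac_eq0. Qed.

Let lQ : lead_coef Q1 != 0.
Proof. by rewrite lead_coef_eq0 -size_poly_gt0 (leq_trans _ sQ). Qed.

Lemma kummer_factor : exists m (u : k) (A B : {poly {poly K}}),
  [/\ (0 < m)%N, u ^+ m = t, (1 < size A)%N, (1 < size B)%N &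
      A * B = Q1 ^:P - 'X^m *: Q2 ^:P].
Proof.
have [m [u [m0 u0 um eig]]] := theta_root P2_neq0 sP.
have t0 : t != 0 by rewrite -um expf_neq0.
have u_nc c : u != cst K c.
  apply/eqP=> uc; move: t0; rewrite -(theta_t P2_neq0 sP) -um uc -rmorphXn.
  by rewrite theta_cst eqxx.
have eigL f : eigensum (theta P1 P2) (cst K) f -> laurent (cst K) u f.
  case=> s [sE ->]; apply: laurent_sum => p /sE pE.
  have [->|p0] := eqVneq p.2 0; first by exists 0%N, 0; rewrite mulr0 (rmorph0 (eval_at _ _)).
  have [b [j ->]] := eig _ _ p0 pE.
  exact: (laurent_monomial (cst K) u0 b j).
pose F := monic_factor phi F0; pose G := monic_factor phi G0.
have GF0 : G0 * F0 = P2 *: Q1 ^:P - P1 *: Q2 ^:P by rewrite mulrC.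
have F_neq0 : F != 0 by rewrite monic_neq0 // (monic_factor_monic phi_neq0 sF0).
have G_neq0 : G != 0 by rewrite monic_neq0 // (monic_factor_monic phi_neq0 sG0).
have FL i : laurent (cst K) u F`_i.
  exact/eigL/(monic_factor_eigensum P2_neq0 sP Q2_neq0 sQ coprimeP coprimeQ _ _ FG0).
have GL i : laurent (cst K) u G`_i.
  exact/eigL/(monic_factor_eigensum P2_neq0 sP Q2_neq0 sQ coprimeP coprimeQ _ _ GF0).
have [N [A [sA AE]]] := laurent_poly u0 u_nc F_neq0 FL.
have [M [B [sB BE]]] := laurent_poly u0 u_nc G_neq0 GL.
have FGE : cst K (lead_coef Q1) *: (F * G) =
    map_poly (cst K) Q1 - u ^+ m *: map_poly (cst K) Q2.
  rewrite um; exact: (monic_factors_curve phi_neq0 sQ FG0 P2_neq0).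
have [A' [B' [sA' sB' E]]] := cancelX (laurent_factor u_nc AE BE FGE).
exists m, u, A', B'; split=> //.
  rewrite sA' size_scale ?polyC_eq0 // sA.
  by rewrite (size_monic_factor phi_neq0 sF0).
by rewrite sB' sB (size_monic_factor phi_neq0 sG0).
Qed.

Theorem reducible_common_power : exists d (R S : k),
  [/\ (1 < d)%N, t = R ^+ d & Q1%:F / Q2%:F = S ^+ d].
Proof.
have [m [u [A [B [m0 um sA sB E]]]]] := kummer_factor.
have BA : B * A = Q1 ^:P - 'X^m *: Q2 ^:P by rewrite mulrC.
have sA' := size_swap_factor coprimeQ m0 E sA.
have sB' := size_swap_factor coprimeQ m0 BA sB.
have [c cE] := norm_of_factor Q2_neq0 m0 phi_neq0 E.
have Q1_neq0 : Q1 != 0 by rewrite -lead_coef_eq0.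
have Q0 : phi Q1 / phi Q2 != 0 by rewrite mulf_neq0 ?invr_eq0 ?phi_neq0.
(* Both factors have positive degree in ['X], and these degrees add up to at most [m]. *)
have jm : (0 < (size (swapXY A)).-1 < m)%N.
  rewrite -ltnS prednK ?sA' /=; last by apply: leq_trans sA'.
  have := congr1 (fun p : {poly {poly K}} => size (swapXY p)) E.
  rewrite /= swapXY_kummer (_ : swapXY (A * B) = swapXY A * swapXY B); last exact: rmorphM.
  have nA : swapXY A != 0 by rewrite -size_poly_gt0 (leq_trans _ sA').
  have nB : swapXY B != 0 by rewrite -size_poly_gt0 (leq_trans _ sB').
  rewrite (size_mul nA nB).
  move=> sAB; have : (size (swapXY A) + size (swapXY B) <= m.+2)%N.
    rewrite -(prednK (_ : 0 < size (swapXY A) + size (swapXY B))%N) ?ltnS ?sAB.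
      rewrite (leq_trans (size_polyD _ _)) // size_polyN geq_max.
      rewrite (leq_trans (size_polyC_leq1 _)) //=.
      rewrite -commr_polyXn mul_polyC (leq_trans (size_scale_leq _ _)) //.
      by rewrite size_polyXn.
    by rewrite addn_gt0 (leq_trans _ sA').
  move=> H; have := leq_trans (leq_add (leqnn (size (swapXY A))) sB') H.
  by rewrite addn2 ltnS.
have [d [e [S [d1 mE SE]]]] := power_of_norm (cst K) Q0 jm cE.
exists d, (u ^+ e), S; split=> //.
by rewrite -exprM -mE.
Qed.

End CoreTheorem.

(** * Moebius changes of coordinates *)

Section Homogenization.
Variable R : comNzRingType.
Implicit Types (p q s t : {poly R}) (n m : nat).

(** The degree [n] homogenization of [p] evaluated at [(s, t)], formally [t ^ n * p(s / t)]. *)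
Definition homp s t n p : {poly R} :=
  \sum_(i < n.+1) p`_i *: (s ^+ i * t ^+ (n - i)).

Lemma homp_is_linear s t n : linear (homp s t n).
Proof.
move=> c p q; rewrite /homp scaler_sumr -big_split /=; apply: eq_bigr => i _.
by rewrite coefD coefZ scalerDl scalerA.
Qed.

HB.instance Definition _ s t n :=
  GRing.isLinear.Build R {poly R} {poly R} _ (homp s t n) (homp_is_linear s t n).

Lemma homp0 s t p : homp s t 0 p = (p`_0)%:P.
Proof. by rewrite /homp big_ord1 !expr0 mulr1 -mul_polyC mulr1. Qed.

Lemma hompC s t n c : homp s t n c%:P = c *: t ^+ n.
Proof.
rewrite /homp big_ord_recl coefC /= mul1r subn0 big1 ?addr0 // => i _.
by rewrite coefC /= scale0r.
Qed.

Lemma hompMX s t n p : homp s t n.+1 (p * 'X) = s * homp s t n p.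
Proof.
rewrite /homp big_ord_recl coefMX /= scale0r add0r mulr_sumr.
apply: eq_bigr => i _; rewrite coefMX /= /bump /= add1n subSS exprS.
by rewrite -scalerAr mulrA.
Qed.

Lemma poly_MXaddC_ex n p : (size p <= n.+2)%N ->
  exists q c, p = q * 'X + c%:P /\ (size q <= n.+1)%N.
Proof.
move=> sp; exists (drop_poly 1 p), p`_0; split.
  rewrite -{1}(poly_take_drop 1 p) addrC; congr (_ + _); apply/polyP=> i.
  by rewrite coef_take_poly coefC; case: i.
by rewrite size_drop_poly leq_subLR.
Qed.

Lemma homp_widen s t n m p : (size p <= n.+1)%N ->
  homp s t (n + m) p = homp s t n p * t ^+ m.
Proof.
elim: n p => [|n IH] p sp.
  by rewrite add0n (size1_polyC sp) !hompC expr0 alg_polyC mul_polyC.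
have [q [c [pE sq]]] := poly_MXaddC_ex sp.
by rewrite pE addSn !linearD /= !hompMX IH // !hompC mulrDl mulrA -scalerAl -exprD addSn.
Qed.

Lemma hompM s t n m p q : (size p <= n.+1)%N -> (size q <= m.+1)%N ->
  homp s t (n + m) (p * q) = homp s t n p * homp s t m q.
Proof.
move=> + sq; elim: n p => [|n IH] p sp.
  by rewrite (size1_polyC sp) mul_polyC linearZ /= hompC expr0 alg_polyC mul_polyC.
have [r [c [pE sr]]] := poly_MXaddC_ex sp.
rewrite pE mulrDl !linearD /= mulrAC addSn hompMX hompMX IH // mulrDl -mulrA.
congr (_ + _); rewrite hompC mul_polyC linearZ /= -addSn addnC homp_widen //.
by rewrite -scalerAl mulrC.
Qed.

Lemma size_exp_top n d p : (size p <= n.+1)%N -> (size (p ^+ d)%R <= (n * d).+1)%N.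
Proof.
move=> sp; apply: leq_trans (size_poly_exp_leq _ _) _.
by rewrite ltnS leq_mul2r -subn1 leq_subLR add1n sp orbT.
Qed.

Lemma size_homp (a b c d : R) n p :
  (size (homp (a *: 'X + b%:P) (c *: 'X + d%:P) n p) <= n.+1)%N.
Proof.
have s1 (u v : R) : (size (u *: 'X + v%:P)%R <= 2)%N.
  rewrite (leq_trans (size_polyD _ _)) // geq_max.
  by rewrite (leq_trans (size_scale_leq _ _)) ?size_polyX // (leq_trans (size_polyC_leq1 _)).
have sX (u v : R) j : (size ((u *: 'X + v%:P) ^+ j)%R <= j.+1)%N.
  by rewrite -[X in (_ <= X.+1)%N]mul1n size_exp_top.
rewrite (leq_trans (size_sum _ _ _)) //; apply/bigmax_leqP => i _.
rewrite (leq_trans (size_scale_leq _ _)) //.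
by rewrite -[X in (_ <= X.+1)%N](subnKC (_ : i <= n)%N) ?sizeM_top // -ltnS.
Qed.

End Homogenization.

Section ProjectiveValues.
Variable K : fieldType.
Implicit Types (p q : {poly K}) (x : projline K) (u v : K).

(* The value at [x] of the degree [n] homogenization of [p]. *)
Definition hval n p x : K := if x is Some z then p.[z] else p`_n.

Lemma hvalD n p q x : hval n (p + q) x = hval n p x + hval n q x.
Proof. by case: x => [z|] /=; rewrite ?hornerD ?coefD. Qed.

Lemma hvalZ n c p x : hval n (c *: p) x = c * hval n p x.
Proof. by case: x => [z|] /=; rewrite ?hornerZ ?coefZ. Qed.

Lemma hvalM n m p q x : (size p <= n.+1)%N -> (size q <= m.+1)%N ->
  hval (n + m) (p * q) x = hval n p x * hval m q x.
Proof. by case: x => [z|] sp sq /=; rewrite ?hornerM ?coefM_top. Qed.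

Lemma hvalX n d p x : (size p <= n.+1)%N -> hval (n * d) (p ^+ d) x = hval n p x ^+ d.
Proof.
move=> sp; elim: d => [|d IH].
  by rewrite muln0 !expr0; case: x => [z|] /=; rewrite ?hornerC // coef1.
by rewrite mulnS !exprS hvalM ?IH ?size_exp_top.
Qed.

Lemma hpointZ r u v : r != 0 -> hpoint (r * u) (r * v) = hpoint u v.
Proof.
move=> r0; rewrite /hpoint mulf_eq0 (negPf r0) /=.
by case: ifP => // _; rewrite -mulf_div divff // mul1r.
Qed.

Lemma hpoint_cross u v u' v' : (u != 0) || (v != 0) -> (u' != 0) || (v' != 0) ->
  hpoint u v = hpoint u' v' -> u * v' = u' * v.
Proof.
rewrite /hpoint => uv uv'.
case: (eqVneq v 0) uv => [->|v0]; case: (eqVneq v' 0) uv' => [->|v'0] //.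
  by rewrite !mulr0.
by move=> _ _ [/eqP]; rewrite eqr_div // => /eqP.
Qed.

Lemma zpow_hpoint d u v : (0 < d)%N -> zpow d (hpoint u v) = hpoint (u ^+ d) (v ^+ d).
Proof.
move=> d0; rewrite /hpoint expf_eq0 d0 /=.
by case: ifP => //= _; rewrite expr_div_n.
Qed.

Section Mobius.
Variables a b c d : K.
Hypothesis det_neq0 : a * d - b * c != 0.

Definition mobius x : projline K :=
  match x with
  | Some z => hpoint (a * z + b) (c * z + d)
  | None => hpoint a c
  end.

Lemma mobius_is_mobius : is_mobius mobius.
Proof. by exists a, b, c, d. Qed.

Lemma mobius_hpoint u v : (u != 0) || (v != 0) ->
  mobius (hpoint u v) = hpoint (a * u + b * v) (c * u + d * v).
Proof.
rewrite {1}/hpoint; case: (eqVneq v 0) => [->|v0] /=.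
  by rewrite orbF !mulr0 !addr0 => u0; rewrite [a * u]mulrC [c * u]mulrC hpointZ.
move=> _; rewrite -(hpointZ _ _ v0); congr hpoint.
  by rewrite mulrDr mulrCA [v * (u / v)]mulrC divfK // mulrC [v * b]mulrC mulrC.
by rewrite mulrDr mulrCA [v * (u / v)]mulrC divfK // mulrC [v * d]mulrC mulrC.
Qed.

Lemma det_mul_neq0 u v : (u != 0) || (v != 0) ->
  (a * u + b * v != 0) || (c * u + d * v != 0).
Proof.
apply: contraTT; rewrite !negb_or !negbK => /andP[/eqP E1 /eqP E2].
apply/andP; split; rewrite -(inj_eq (mulfI det_neq0)) mulr0; apply/eqP.
  transitivity (d * (a * u + b * v) - b * (c * u + d * v)); first by ring.
  by rewrite E1 E2 !mulr0 subrr.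
transitivity (a * (c * u + d * v) - c * (a * u + b * v)); first by ring.
by rewrite E1 E2 !mulr0 subrr.
Qed.

Notation s := (a *: 'X + b%:P).
Notation t := (c *: 'X + d%:P).

(** Two choices of homogeneous coordinates for [mobius x] differ by a scalar; [r] is its [n]-th
    power, the same for every [p]. *)
Lemma hval_homp n x : exists2 r, r != 0 &
  forall p, (size p <= n.+1)%N -> hval n (homp s t n p) x = r * hval n p (mobius x).
Proof.
have hl (u v : K) : hval 1 (u *: 'X + v%:P) x = if x is Some z then u * z + v else u.
  by case: x => [z|] /=; rewrite ?hornerE // coefD coefZ coefX coefC /= mulr1 addr0.
have xE : mobius x = hpoint (hval 1 s x) (hval 1 t x) by rewrite !hl; case: x {hl}.
have st0 : (hval 1 s x != 0) || (hval 1 t x != 0).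
  rewrite !hl; case: x {hl xE} => [z|].
    rewrite -[b]mulr1 -[d]mulr1; apply: det_mul_neq0.
    by rewrite oner_neq0 orbT.
  by have := @det_mul_neq0 1 0; rewrite !mulr0 !addr0 !mulr1; apply; rewrite oner_neq0.
set sx := hval 1 s x in xE st0; set tx := hval 1 t x in xE st0.
have szl (u v : K) : (size (u *: 'X + v%:P)%R <= 2)%N.
  rewrite (leq_trans (size_polyD _ _)) // geq_max.
  by rewrite (leq_trans (size_scale_leq _ _)) ?size_polyX // (leq_trans (size_polyC_leq1 _)).
have hX (p : {poly K}) j : (size p <= 2)%N -> hval j (p ^+ j) x = hval 1 p x ^+ j.
  by move=> sp; rewrite -{1}[j]mul1n hvalX.
have E p : hval n (homp s t n p) x = \sum_(i < n.+1) p`_i * (sx ^+ i * tx ^+ (n - i)).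
  rewrite /homp; have hsum (I : finType) (F : I -> {poly K}) :
      hval n (\sum_i F i) x = \sum_i hval n (F i) x.
    by clear; case: x => [z|] /=; rewrite ?horner_sum ?coef_sum.
  rewrite hsum; apply: eq_bigr => i _; rewrite hvalZ; congr (_ * _).
  have le : (i <= n)%N by rewrite -ltnS.
  rewrite -{1}(subnKC le) hvalM.
  - by rewrite (hX _ i) // (hX _ (n - i)%N).
  - by rewrite -[X in (_ <= X.+1)%N]mul1n size_exp_top.
  - by rewrite -[X in (_ <= X.+1)%N]mul1n size_exp_top.
rewrite xE /hpoint; case: (eqVneq tx 0) st0 => [t0|t0] st0.
  rewrite orbF in st0; exists (sx ^+ n); first by rewrite expf_neq0.
  move=> p sp; rewrite E big_ord_recr /= subnn expr0 mulr1 big1 ?add0r 1?mulrC //.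
  by move=> i _; rewrite t0 expr0n subn_eq0 leqNgt ltn_ord /= !mulr0.
exists (tx ^+ n); first by rewrite expf_neq0.
move=> p sp; rewrite E /= (horner_coef_wide _ sp) mulr_sumr.
apply: eq_bigr => i _; rewrite expr_div_n.
have le : (i <= n)%N by rewrite -ltnS.
have ti : tx ^+ i != 0 by rewrite expf_neq0.
have -> : tx ^+ n = tx ^+ (n - i) * tx ^+ i by rewrite -exprD subnK.
by move: (sx ^+ i) (tx ^+ i) (tx ^+ (n - i)) ti => A B C B0; field.
Qed.

End Mobius.

Lemma hpoint_rep x : exists u v, ((u != 0) || (v != 0)) /\ x = hpoint u v.
Proof.
case: x => [z|]; first by exists z, 1; rewrite /hpoint oner_eq0 divr1 orbT.
by exists 1, 0; rewrite /hpoint eqxx oner_eq0.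
Qed.

Lemma mobiusK a b c d : a * d - b * c != 0 ->
  cancel (mobius d (- b) (- c) a) (mobius a b c d).
Proof.
move=> det y; have [u [v [uv ->]]] := hpoint_rep y.
have det' : d * a - - b * - c != 0 by rewrite mulrNN [d * a]mulrC.
rewrite mobius_hpoint // mobius_hpoint ?det_mul_neq0 //.
by rewrite -[RHS](hpointZ u v det); congr hpoint; ring.
Qed.

Section RatmapValues.
Variables (P1 P2 : {poly K}).
Hypotheses (P2_neq0 : P2 != 0) (coprimeP : coprimep P1 P2).
Let n := (maxn (size P1) (size P2)).-1.

Lemma ratmap_hval x : ratmap (P1%:F / P2%:F) x = hpoint (hval n P1 x) (hval n P2 x).
Proof. by case: x => [z|]; [exact: ratmapE | exact: ratmap_inftyE]. Qed.

Lemma hval_neq0 x : (hval n P1 x != 0) || (hval n P2 x != 0).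
Proof.
case: x => [z|] /=.
  rewrite -negb_and; apply/andP => -[P1z P2z].
  by move: (coprimep_root coprimeP P1z); rewrite P2z.
have [le|/ltnW le] := leqP (size P1) (size P2).
  by rewrite /n (maxn_idPr le) -lead_coefE lead_coef_eq0 P2_neq0 orbT.
have P1_neq0 : P1 != 0 by rewrite -size_poly_gt0 (leq_trans _ le) ?size_poly_gt0.
by rewrite /n (maxn_idPl le) -lead_coefE lead_coef_eq0 P1_neq0.
Qed.

End RatmapValues.

End ProjectiveValues.

Local Open Scope classical_set_scope.
Local Open Scope card_scope.

Lemma card_eq2 (T : Type) (A : set T) : A #= `I_2 ->
  exists x y, [/\ A x, A y, x <> y & forall z, A z -> z = x \/ z = y].
Proof.
move=> /card_set_bijP[f [fA finj fsurj]].
have [x Ax fx] := fsurj 0%N isT; have [y Ay fy] := fsurj 1%N isT.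
exists x, y; split=> //; first by move=> xy; move: fx; rewrite xy fy.
move=> z Az; have := fA z Az; rewrite /=.
by case E: (f z) => [|[|//]] _; [left | right]; apply: finj; rewrite ?inE ?E.
Qed.

(** * Moving two values to 0 and infinity *)

Section FewPoints.
Variable K : numClosedFieldType.

Lemma separable_polyZ (c : K) (p : {poly K}) : c != 0 ->
  separable_poly (c *: p) = separable_poly p.
Proof. by move=> c0; rewrite unlock derivZ coprimepZl // coprimepZr. Qed.

Lemma nonseparable_roots (f : {poly K}) n : size f = n.+1 -> ~~ separable_poly f ->
  exists2 r : seq K, (size r < n)%N & forall z, root f z -> z \in r.
Proof.
move=> sf; have [r fE] := closed_field_poly_normal f.
have l0 : lead_coef f != 0 by rewrite lead_coef_eq0 -size_poly_gt0 sf.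
have sr : size r = n.
  by move: sf; rewrite fE size_scale // size_prod_XsubC => -[].
rewrite {1}fE separable_polyZ // separable_prod_XsubC -ltn_size_undup sr => su.
exists (undup r) => // z; rewrite fE rootZ // root_prod_XsubC.
by rewrite mem_undup.
Qed.

Section NormalForm.
Variables (P1 P2 : {poly K}) (al be ga de : K).
Hypotheses (P2_neq0 : P2 != 0) (coprimeP : coprimep P1 P2).
Hypothesis det_neq0 : al * de - be * ga != 0.
Notation n := (maxn (size P1) (size P2)).-1.
Hypothesis n_gt0 : (0 < n)%N.
Notation T1 := (al *: P1 + be *: P2).
Notation T2 := (ga *: P1 + de *: P2).

Lemma size_pencil u v : (size (u *: P1 + v *: P2)%R <= n.+1)%N.
Proof.
rewrite (leq_trans (size_polyD _ _)) // geq_max prednK; last first.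
  by rewrite (leq_trans n_gt0) ?leq_pred.
by rewrite !(leq_trans (size_scale_leq _ _)) // ?leq_maxl ?leq_maxr.
Qed.

Lemma hval_pencil u v x :
  hval n (u *: P1 + v *: P2) x = u * hval n P1 x + v * hval n P2 x.
Proof. by rewrite hvalD !hvalZ. Qed.

Lemma hval_target_neq0 x : (hval n T1 x != 0) || (hval n T2 x != 0).
Proof. by rewrite !hval_pencil det_mul_neq0 ?hval_neq0. Qed.

(** A drop in degree counts as a zero at infinity. *)
Lemma hval_has_zero (p : {poly K}) m : (0 < m)%N -> (size p <= m.+1)%N ->
  exists x, hval m p x = 0.
Proof.
move=> m0; rewrite leq_eqVlt => /orP[/eqP sp|sp]; last first.
  by exists None; rewrite /= nth_default.
have /closed_rootP[z pz] : size p != 1 by rewrite sp eqSS -lt0n.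
by exists (Some z); apply/eqP.
Qed.

Lemma ratmap_target x :
  ratmap (P1%:F / P2%:F) x = mobius de (- be) (- ga) al (hpoint (hval n T1 x) (hval n T2 x)).
Proof.
have nz := hval_target_neq0 x.
rewrite ratmap_hval // mobius_hpoint // !hval_pencil.
by rewrite -(hpointZ _ _ det_neq0); congr hpoint; ring.
Qed.

Lemma target_nonzero : exists x, hval n T2 x != 0.
Proof.
have [x x0] := hval_has_zero n_gt0 (size_pencil al be).
by exists x; have := hval_target_neq0 x; rewrite x0 eqxx.
Qed.

Lemma mobius_to_infinity (x : projline K) :
  exists a b c d, a * d - b * c != 0 /\ mobius a b c d None = x.
Proof.
case: x => [z|]; last first.
  by exists 1, 0, 0, 1; rewrite mulr1 mulr0 subr0 oner_neq0 /= /hpoint eqxx.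
by exists z, 1, 1, 0; rewrite mulr0 sub0r mulr1 oppr_eq0 oner_neq0 /= /hpoint oner_eq0 divr1.
Qed.

(** The source coordinate is chosen so that infinity goes to a zero of [T2], which makes the degree
    of [p2] smaller. The point in the last clause is the value [r] carried back to the original
    target. *)
Lemma normal_form : exists a b c d,
  let s := a *: 'X + b%:P in let t := c *: 'X + d%:P in
  let p1 := homp s t n T1 in let p2 := homp s t n T2 in
  [/\ a * d - b * c != 0, size p1 = n.+1, (size p2 < size p1)%N /\ p2 != 0,
      coprimep p1 p2 &
      forall r, ~~ separable_poly (p1 - r *: p2) ->
      critical_values (P1%:F / P2%:F) (hpoint (r * de - be) (al - r * ga))].
Proof.
have [x0 x0E] := hval_has_zero n_gt0 (size_pencil ga de).
have [a [b [c [d [det' nuE]]]]] := mobius_to_infinity x0.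
exists a, b, c, d => s t p1 p2.
have val x : exists2 r, r != 0 & hval n p1 x = r * hval n T1 (mobius a b c d x) /\
    hval n p2 x = r * hval n T2 (mobius a b c d x).
  have [r r0 rE] := hval_homp det' n x.
  by exists r => //; rewrite !rE ?size_pencil.
have [r0 r00 [E1 E2]] := val None.
have p1n : p1`_n != 0.
  rewrite -[p1`_n]/(hval n p1 None) E1 mulf_neq0 // nuE.
  by have := hval_target_neq0 x0; rewrite x0E eqxx orbF.
have p2n : p2`_n = 0 by rewrite -[p2`_n]/(hval n p2 None) E2 nuE x0E mulr0.
have sp1 : size p1 = n.+1.
  apply/anti_leq; rewrite size_homp /= ltnNge; apply: contra p1n => le.
  by rewrite nth_default.
have sp2 : (size p2 < size p1)%N.
  rewrite sp1 ltnS; apply/leq_sizeP => j; rewrite leq_eqVlt => /orP[/eqP<-//|nj].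
  by rewrite nth_default // (leq_trans (size_homp _ _ _ _ _ _)).
have cop : coprimep p1 p2.
  apply: Pdiv.ClosedField.root_coprimep => z p1z.
  have [r rn0 [e1 e2]] := val (Some z); rewrite -[p2.[z]]/(hval n p2 (Some z)) e2.
  rewrite mulf_neq0 //; move: p1z; rewrite rootE -[p1.[z]]/(hval n p1 (Some z)) e1.
  rewrite mulf_eq0 (negPf rn0) orFb => /eqP H.
  by have := hval_target_neq0 (mobius a b c d (Some z)); rewrite H eqxx.
split=> //.
  split=> //; apply/negP=> /eqP p20; move: cop; rewrite p20 coprimep0.
  by move/eqp_size; rewrite size_poly1 sp1 => -[n0]; move: n_gt0; rewrite n0.
move=> r nsep; have sf : size (p1 - r *: p2) = n.+1.
  rewrite size_polyDl ?sp1 // size_polyN (leq_ltn_trans (size_scale_leq _ _)) //.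
  by rewrite -sp1.
have [rs srs rsE] := nonseparable_roots sf nsep.
rewrite /critical_values /= ratdegE // => le.
pose G i := mobius a b c d (Some (nth 0 rs i)).
have sub : ratmap (P1%:F / P2%:F) @^-1` [set hpoint (r * de - be) (al - r * ga)]
    `<=` G @` `I_(size rs).
  move=> x /=; rewrite ratmap_hval // => xE.
  have cross : hval n T1 x = r * hval n T2 x.
    have nz : (r * de - be != 0) || (al - r * ga != 0).
      apply: contraTT det_neq0; rewrite negb_or !negbK !subr_eq0 => /andP[/eqP<- /eqP->].
      by apply/eqP; ring.
    have := hpoint_cross (hval_neq0 P2_neq0 coprimeP x) nz xE.
    rewrite !hval_pencil => H; apply/eqP; rewrite -subr_eq0; apply/eqP.
    transitivity (hval n P1 x * (al - r * ga) - (r * de - be) * hval n P2 x); first by ring.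
    by rewrite H subrr.
  have [y yE] : exists y, mobius a b c d y = x by eexists; exact: mobiusK.
  have [q q0 [e1 e2]] := val y; rewrite yE in e1 e2.
  have fy : hval n (p1 - r *: p2) y = 0.
    by rewrite -scaleNr hvalD hvalZ e1 e2 cross; ring.
  (* Infinity is not in this fibre, because [p2] has lost its top coefficient and [p1] has not. *)
  case: y yE fy {e1 e2} => [z|] yE fy; last first.
    move: fy; rewrite /= coefB coefZ p2n mulr0 subr0 => /eqP.
    by rewrite (negPf p1n).
  have zr : z \in rs by apply: rsE; apply/eqP.
  exists (index z rs); first by rewrite /= index_mem.
  by rewrite /G nth_index.
have : `I_n #<= `I_(size rs).
  apply: (card_le_trans le); apply: (card_le_trans (subset_card_le sub)).
  exact: card_image_le.
by rewrite card_le_II leqNgt srs.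
Qed.

End NormalForm.
End FewPoints.

(** * Factorizations and powers under changes of coordinates *)

Section HompFactor.
Variable R : idomainType.
Variables (a b c d : R).
Notation s := (a *: 'X + b%:P).
Notation t := (c *: 'X + d%:P).
Implicit Types V W : {poly R}.

(** [V] is given its exact degree [v] and [W] the formal degree [n - v]. Since the transformed
    product attains degree [n], both images attain their formal degrees; a constant image then has
    formal degree 0, where the transformation is the identity. *)
Lemma homp_factor n V W : (size (V * W)%R <= n.+1)%N ->
  size (homp s t n (V * W)) = n.+1 -> exists V' W',
  [/\ V' * W' = homp s t n (V * W), (size V' <= 1)%N -> V' = V &
      (size W' <= 1)%N -> W' = W].
Proof.
move=> sH sh; have VW0 : V * W != 0.
  by apply: contra_eq_neq sh => ->; rewrite linear0 size_poly0.
move: (VW0); rewrite mulf_eq0 negb_or => /andP[V0 W0].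
pose v := (size V).-1; have sV : size V = v.+1 by rewrite prednK // size_poly_gt0.
move: sH; rewrite size_mul // sV addSn /= => sH.
have vn : (v <= n)%N.
  rewrite -ltnS (leq_trans _ sH) // -addn1 leq_add2l size_poly_gt0 //.
have sW : (size W <= (n - v).+1)%N by rewrite -subSn // leq_subRL // (leq_trans vn).
pose V' := homp s t v V; pose W' := homp s t (n - v) W.
have E : V' * W' = homp s t n (V * W).
  by rewrite -[in RHS](subnKC vn) hompM // sV.
have sV' : (size V' <= v.+1)%N by apply: size_homp.
have sW' : (size W' <= (n - v).+1)%N by apply: size_homp.
have : V' * W' != 0 by rewrite E -size_poly_gt0 sh.
rewrite mulf_eq0 negb_or => /andP[V'0 W'0].
move: sh; rewrite -E size_mul // => sh.
have sum : (size V' + size W' = n.+2)%N.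
  by rewrite -sh prednK // addn_gt0 size_poly_gt0 V'0.
have eV : size V' = v.+1.
  apply/anti_leq; rewrite sV' /= -(leq_add2r (size W')) sum.
  apply: leq_trans (leq_add (leqnn v.+1) sW') _.
  by rewrite addSn addnS subnKC.
have eW : size W' = (n - v).+1.
  by apply/eqP; rewrite -(eqn_add2l v.+1) -{1}eV sum addSn addnS subnKC.
exists V', W'; split=> // [|].
  rewrite eV ltnS leqn0 => /eqP v0.
  by rewrite /V' v0 homp0 -size1_polyC // sV v0.
rewrite eW ltnS leqn0 => /eqP w0.
by rewrite /W' w0 homp0 -size1_polyC // (leq_trans sW) // w0.
Qed.

End HompFactor.

Section Pullback.
Variable K : numClosedFieldType.

(** In lowest terms the two fractions agree up to a common scalar, which has a [d]-th root in
    [K]. *)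
Lemma common_power (p1 p2 : {poly K}) (R : ratfun K) d n : (0 < d)%N ->
  p2 != 0 -> size p1 = n.+1 -> (size p2 <= n.+1)%N -> coprimep p1 p2 ->
  p1%:F / p2%:F = R ^+ d -> exists e (A B : {poly K}),
  [/\ n = (e * d)%N, (size A <= e.+1)%N, (size B <= e.+1)%N, p1 = A ^+ d & p2 = B ^+ d].
Proof.
move=> d0 p20 sp1 sp2 cop RE; have [a [b [b0 ab RabE]]] := ratfunP R.
have bd0 : b ^+ d != 0 by rewrite expf_neq0.
have E : p1 * b ^+ d = a ^+ d * p2.
  by apply: tofrac_cross => //; rewrite RE RabE expr_div_n !tofracXn.
have copd : coprimep (b ^+ d) (a ^+ d) by rewrite coprimep_expl // coprimep_expr // coprimep_sym.
have d1 : b ^+ d %| p2 by rewrite -(Gauss_dvdpr _ copd) -E dvdp_mull.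
have d2 : p2 %| b ^+ d.
  by rewrite -(@Gauss_dvdpr _ _ p1) ?E ?dvdp_mull // coprimep_sym.
have /eqpf_eq[c c0 p2E] : p2 %= b ^+ d by rewrite /eqp d2 d1.
have p1E : p1 = c *: a ^+ d.
  by apply: (mulIf bd0); rewrite E p2E -scalerAl -scalerAr.
pose k := d.-root c; have kd : k ^+ d = c by rewrite rootCK.
pose A := k *: a; pose B := k *: b.
have AE : p1 = A ^+ d by rewrite exprZn kd.
have BE : p2 = B ^+ d by rewrite exprZn kd.
have A0 : A != 0.
  have : p1 != 0 by rewrite -size_poly_gt0 sp1.
  by rewrite AE expf_eq0 d0.
have B0 : B != 0 by move: p20; rewrite BE expf_eq0 d0.
have nE : n = ((size A).-1 * d)%N by rewrite -size_exp -AE sp1.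
exists (size A).-1, A, B; split=> //; first exact: leqSpred.
apply: leq_trans (leqSpred _) _; rewrite ltnS -(leq_pmul2r d0) -nE -size_exp -BE.
by rewrite -subn1 leq_subLR add1n.
Qed.

(** [A] and [B] are transported by the inverse change of source coordinate; the scalars this
    introduces cancel in homogeneous coordinates. *)
Lemma pullback (a b c d : K) e D n (A B T1 T2 : {poly K}) :
  let s := a *: 'X + b%:P in let t := c *: 'X + d%:P in
  a * d - b * c != 0 -> (0 < D)%N -> n = (e * D)%N ->
  (size A <= e.+1)%N -> (size B <= e.+1)%N ->
  (size T1 <= n.+1)%N -> (size T2 <= n.+1)%N ->
  homp s t n T1 = A ^+ D -> homp s t n T2 = B ^+ D ->
  (forall x, (hval n T1 x != 0) || (hval n T2 x != 0)) ->
  (exists x, hval n T2 x != 0) ->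
  exists R, forall x, hpoint (hval n T1 x) (hval n T2 x) = zpow D (ratmap R x).
Proof.
move=> s t det D0 nE sA sB sT1 sT2 E1 E2 T0 [x0 T2x0].
have det' : d * a - - b * - c != 0 by rewrite mulrNN [d * a]mulrC.
pose s' := d *: 'X + (- b)%:P; pose t' := - c *: 'X + a%:P.
pose A' := homp s' t' e A; pose B' := homp s' t' e B.
have val x : exists r r', [/\ r != 0, r' != 0,
    hval e A' x ^+ D = r * (r' * hval n T1 x) &
    hval e B' x ^+ D = r * (r' * hval n T2 x)].
  have [r r0 rE] := hval_homp det' e x.
  have [r' r'0 r'E] := hval_homp det n (mobius d (- b) (- c) a x).
  exists (r ^+ D), r'; rewrite expf_neq0 //; split=> //.
    by rewrite rE // exprMn -hvalX // -nE -E1 r'E // mobiusK.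
  by rewrite rE // exprMn -hvalX // -nE -E2 r'E // mobiusK.
have A'B' x : (hval e A' x != 0) || (hval e B' x != 0).
  have [r [r' [r0 r'0 e1 e2]]] := val x.
  have := T0 x; apply: contraTT; rewrite !negb_or !negbK => /andP[/eqP h1 /eqP h2].
  move: e1 e2; rewrite h1 h2 expr0n gtn_eqF // => /esym/eqP + /esym/eqP.
  by rewrite !mulf_eq0 (negPf r0) (negPf r'0) /= => -> ->.
have B'0 : B' != 0.
  apply/negP=> /eqP B'0; have [r [r' [r0 r'0 _]]] := val x0.
  have -> : hval e B' x0 = 0 by rewrite B'0; case: (x0) => [z|] /=; rewrite ?horner0 ?coef0.
  rewrite expr0n gtn_eqF // => /esym/eqP.
  by rewrite !mulf_eq0 (negPf r0) (negPf r'0) (negPf T2x0).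
have cop : coprimep A' B'.
  apply: Pdiv.ClosedField.root_coprimep => z A'z.
  by have := A'B' (Some z); rewrite /= (eqP A'z) eqxx.
(* The formal degree [e] is the true degree of the fraction because [A'] and [B'] do not both vanish
   at infinity. *)
have eE : (maxn (size A') (size B')).-1 = e.
  have sA' : (size A' <= e.+1)%N by apply: size_homp.
  have sB' : (size B' <= e.+1)%N by apply: size_homp.
  suff -> : maxn (size A') (size B') = e.+1 by [].
  apply/anti_leq; rewrite geq_max sA' sB' /= leqNgt; apply/negP.
  rewrite ltnS geq_max => /andP[lA lB].
  by have := A'B' None; rewrite /= !nth_default // eqxx.
exists (A'%:F / B'%:F) => x; rewrite ratmap_hval // eE zpow_hpoint //.
have [r [r' [r0 r'0 -> ->]]] := val x.
by rewrite !hpointZ.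
Qed.

End Pullback.

Section ScalarFactor.
Variable K : fieldType.
Implicit Types p q : {poly K}.

(** The leading coefficient in the outer variable is [p2] times a nonzero constant, so [v] divides
    [p2]; the coefficient in the degree of [q2] then shows that [v] divides [p1]. *)
Lemma content_curve (p1 p2 q1 q2 v : {poly K}) (w : {poly {poly K}}) :
  coprimep p1 p2 -> q2 != 0 -> (size q2 < size q1)%N ->
  v *: w = p2 *: q1 ^:P - p1 *: q2 ^:P -> size v = 1%N.
Proof.
move=> cop q20 sq E.
have E' i : v * w`_i = p2 * (q1`_i)%:P - p1 * (q2`_i)%:P.
  by have := congr1 (fun p : {poly {poly K}} => p`_i) E; rewrite coefB !coefZ !coef_map.
have q10 : q1 != 0 by rewrite -size_poly_gt0 (leq_trans _ sq).
have vp2 : v %| p2.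
  rewrite -(dvdpZr (c := lead_coef q1)) ?lead_coef_eq0 //.
  apply/dvdpP; exists w`_(size q1).-1; rewrite mulrC E' [q2`__]nth_default.
    by rewrite mulr0 subr0 -lead_coefE mulrC mul_polyC.
  by rewrite -ltnS prednK // size_poly_gt0.
have vp1 : v %| p1.
  rewrite -(dvdpZr (c := lead_coef q2)) ?lead_coef_eq0 //.
  have -> : lead_coef q2 *: p1 = p2 * (q1`_(size q2).-1)%:P - v * w`_(size q2).-1.
    by rewrite E' opprB addrC subrK -lead_coefE mulrC mul_polyC.
  by rewrite dvdp_sub // ?dvdp_mulr // dvdp_mulIl.
apply/eqP; rewrite -dvdp1; have : v %| gcdp p1 p2 by rewrite dvdp_gcd vp1.
by move: cop; rewrite -gcdp_eqp1 => /eqp_dvdr->.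
Qed.

Lemma swapXY_curve (p1 p2 u1 u2 : {poly K}) :
  swapXY (u2 *: p1 ^:P - u1 *: p2 ^:P) = p1 *: u2 ^:P - p2 *: u1 ^:P.
Proof.
have sw (u p : {poly K}) : swapXY (u *: p ^:P) = p *: u ^:P.
  have := swapXY_is_scalable u (p ^:P); rewrite /= (swapXY_map_polyC p) => ->.
  by rewrite mulrC mul_polyC.
transitivity (swapXY (u2 *: p1 ^:P) - swapXY (u1 *: p2 ^:P)); first exact: raddfB.
by rewrite !sw.
Qed.

Lemma homp_map_polyC (s t p : {poly K}) n :
  homp (s ^:P) (t ^:P) n (p ^:P) = (homp s t n p) ^:P.
Proof.
transitivity (\sum_(i < n.+1) (p`_i *: (s ^+ i * t ^+ (n - i))) ^:P); last first.
  by symmetry; exact: raddf_sum.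
apply: eq_bigr => i _; rewrite (map_polyZ polyC) coef_map; congr (_ *: _).
transitivity ((s ^+ i) ^:P * (t ^+ (n - i)) ^:P); last by symmetry; exact: rmorphM.
by congr (_ * _); symmetry; exact: rmorphXn.
Qed.

Lemma map_polyC_linear (a b : K) :
  (a *: 'X + b%:P) ^:P = a%:P *: 'X + (b%:P)%:P :> {poly {poly K}}.
Proof.
transitivity ((a *: 'X) ^:P + b%:P ^:P); first exact: raddfD.
by rewrite map_polyZ map_polyX (map_polyC polyC).
Qed.

Lemma poly_poly_unit (c : K) : c != 0 -> (c%:P%:P : {poly {poly K}}) \is a GRing.unit.
Proof.
move=> c0; rewrite poly_unitE size_polyC polyC_eq0 c0 /= coefC.
by rewrite poly_unitE size_polyC c0 coefC unitfE.
Qed.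

End ScalarFactor.

Section Transfer.
Variable K : numClosedFieldType.
Variables (a b c d a' b' c' d' : K) (n m : nat) (T1 T2 U1 U2 : {poly K}).
Notation px := (homp (a *: 'X + b%:P) (c *: 'X + d%:P) n).
Notation qy := (homp (a' *: 'X + b'%:P) (c' *: 'X + d'%:P) m).
Notation p1 := (px T1).
Notation p2 := (px T2).
Notation q1 := (qy U1).
Notation q2 := (qy U2).
Hypotheses (sT1 : (size T1 <= n.+1)%N) (sT2 : (size T2 <= n.+1)%N).
Hypotheses (sU1 : (size U1 <= m.+1)%N) (sU2 : (size U2 <= m.+1)%N).
Hypotheses (sp1 : size p1 = n.+1) (sp : (size p2 < size p1)%N) (p2_neq0 : p2 != 0).
Hypotheses (sq1 : size q1 = m.+1) (sq : (size q2 < size q1)%N) (q2_neq0 : q2 != 0).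
Hypothesis coprime_p : coprimep p1 p2.

Let size_pencil_curve (u1 u2 t1 t2 : {poly K}) k : (size t1 <= k.+1)%N ->
  (size t2 <= k.+1)%N -> (size (u2 *: t1 ^:P - u1 *: t2 ^:P)%R <= k.+1)%N.
Proof.
move=> s1 s2; rewrite (leq_trans (size_polyD _ _)) // size_polyN geq_max.
by rewrite !(leq_trans (size_scale_leq _ _)) // size_map_polyC.
Qed.

Let homp_curve (e f g h : K) k (u1 u2 t1 t2 : {poly K}) :
  homp (e%:P *: 'X + f%:P%:P) (g%:P *: 'X + h%:P%:P) k
    (u2 *: t1 ^:P - u1 *: t2 ^:P) =
  u2 *: (homp (e *: 'X + f%:P) (g *: 'X + h%:P) k t1) ^:P
    - u1 *: (homp (e *: 'X + f%:P) (g *: 'X + h%:P) k t2) ^:P.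
Proof. by rewrite linearB !linearZ /= -!map_polyC_linear !homp_map_polyC. Qed.

(** Coordinates change in [x] over [K[y]], then in [y] over [K[x]]. A final factor free of [y] is a
    constant by [content_curve]; constants come only from constants in both steps, so [V] or [W]
    would be a unit. *)
Lemma curve_transfer (V W : {poly {poly K}}) :
  V \isn't a GRing.unit -> W \isn't a GRing.unit ->
  V * W = U2 *: T1 ^:P - U1 *: T2 ^:P ->
  exists F0 G0 : {poly {poly K}},
    [/\ (1 < size F0)%N, (1 < size G0)%N & F0 * G0 = p2 *: q1 ^:P - p1 *: q2 ^:P].
Proof.
move=> Vn Wn E; have U20 : U2 != 0.
  by apply: contraNneq q2_neq0 => ->; rewrite linear0.
have sE : (size (V * W)%R <= n.+1)%N by rewrite E size_pencil_curve.
have [|V1 [W1 [E1 V1V W1W]]] := @homp_factor _ a%:P b%:P c%:P d%:P n V W sE.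
  by rewrite E homp_curve (size_curve _ sp U20).
(* Swapping the variables exchanges the two terms of the difference; the sign is absorbed by the
   first factor. *)
have {E1} E1 : - swapXY V1 * swapXY W1 = p2 *: U1 ^:P - p1 *: U2 ^:P.
  rewrite mulNr; have <- : swapXY (V1 * W1) = swapXY V1 * swapXY W1 by exact: rmorphM.
  by rewrite E1 E homp_curve swapXY_curve opprB.
have sE1 : (size (- swapXY V1 * swapXY W1)%R <= m.+1)%N.
  by rewrite E1 size_pencil_curve.
have [|V2 [W2 [E2 V2V W2W]]] := @homp_factor _ a'%:P b'%:P c'%:P d'%:P m
    (- swapXY V1) (swapXY W1) sE1.
  by rewrite E1 homp_curve (size_curve _ sq p2_neq0).
rewrite E1 homp_curve in E2.
have unit_of (F G : {poly {poly K}}) : F * G = p2 *: q1 ^:P - p1 *: q2 ^:P ->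
    (size F <= 1)%N -> exists2 k, k != 0 & F = k%:P%:P.
  move=> FG /size1_polyC FE; move: FG; rewrite FE mul_polyC => FG.
  have /eqP/size_poly1P[k k0 kE] := content_curve coprime_p q2_neq0 sq FG.
  by exists k; rewrite ?kE.
have swC (k : K) : swapXY (k%:P%:P) = k%:P%:P.
  by rewrite swapXY_polyC; exact: map_polyC.
exists V2, W2; split=> //; rewrite ltnNge; apply/negP => small.
  have [k k0 kE] := unit_of _ _ E2 small; case/negP: Vn.
  have V1E : V1 = (- k)%:P%:P.
    rewrite -(swapXYK V1) -[swapXY V1]opprK -(V2V small) kE.
    by rewrite -!polyCN swC.
  rewrite -(V1V _) ?V1E ?size_polyC_leq1 //.
  by apply: poly_poly_unit; rewrite oppr_eq0.
have [k k0 kE] := unit_of W2 V2 (etrans (mulrC _ _) E2) small; case/negP: Wn.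
have W1E : W1 = k%:P%:P by rewrite -(swapXYK W1) -(W2W small) kE swC.
by rewrite -(W1W _) ?W1E ?size_polyC_leq1 ?poly_poly_unit.
Qed.

End Transfer.

(** * From a factorization to a common power map *)

Section Forward.
Variables (K : numClosedFieldType) (P1 P2 Q1 Q2 : {poly K}).
Hypotheses (P2_neq0 : P2 != 0) (coprimeP : coprimep P1 P2).
Hypotheses (Q2_neq0 : Q2 != 0) (coprimeQ : coprimep Q1 Q2).
Notation P := (P1%:F / P2%:F).
Notation Q := (Q1%:F / Q2%:F).
Hypothesis two_common : critical_values P `&` critical_values Q #= `I_2.

Lemma critical_ratdeg (F : ratfun K) x : critical_values F x -> (0 < ratdeg F)%N.
Proof.
rewrite /critical_values /= lt0n => nle; apply/negP => /eqP d0; apply: nle.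
by rewrite d0 II0 card_ge0.
Qed.

Lemma reducible_factor : reducible (hcurve P1 P2 Q1 Q2) ->
  exists (R S : ratfun K) (mu : projline K -> projline K) (d : nat),
    [/\ is_mobius mu, (1 < d)%N,
        ratmap P =1 mu \o zpow d \o ratmap R &
        ratmap Q =1 mu \o zpow d \o ratmap S].
Proof.
move=> [V [W [Vn Wn VW]]].
have [c1 [c2 [[Pc1 Qc1] [Pc2 _] c12 only]]] := card_eq2 two_common.
have [u1 [v1 [uv1 c1E]]] := hpoint_rep c1.
have [u2 [v2 [uv2 c2E]]] := hpoint_rep c2.
(* [T1] will vanish over [c1] and [T2] over [c2], so the new target coordinate takes the values 0
   and infinity there. *)
pose al := v1; pose be := - u1; pose ga := v2; pose de := - u2.
have det : al * de - be * ga != 0.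
  apply/negP=> /eqP det0; apply: c12; rewrite c1E c2E /hpoint.
  have E : u1 * v2 = u2 * v1.
    apply/eqP; rewrite -subr_eq0; apply/eqP; rewrite -[RHS]det0 /al /be /ga /de; ring.
  have [v10|v10] := eqVneq v1 0.
    move: E uv1; rewrite v10 mulr0 eqxx orbF => /eqP; rewrite mulf_eq0 => /orP[/eqP->|/eqP->].
      by rewrite eqxx.
    by rewrite eqxx.
  have [v20|v20] := eqVneq v2 0.
    move: E uv2; rewrite v20 mulr0 eqxx orbF => /esym/eqP; rewrite mulf_eq0 (negPf v10) orbF.
    by move/eqP->; rewrite eqxx.
  by congr Some; apply/eqP; rewrite eqr_div // E.
pose n := (maxn (size P1) (size P2)).-1; pose m := (maxn (size Q1) (size Q2)).-1.
have n0 : (0 < n)%N by have := critical_ratdeg Pc1; rewrite ratdegE.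
have m0 : (0 < m)%N by have := critical_ratdeg Qc1; rewrite ratdegE.
have [a [b [c [d]]]] := normal_form P2_neq0 coprimeP det n0.
set s := a *: 'X + b%:P; set t := c *: 'X + d%:P => /=.
set T1 := al *: P1 + be *: P2; set T2 := ga *: P1 + de *: P2.
move=> [detx sp1 [sp p20] copp critP].
have [a' [b' [c' [d']]]] := normal_form Q2_neq0 coprimeQ det m0.
set s' := a' *: 'X + b'%:P; set t' := c' *: 'X + d'%:P => /=.
set U1 := al *: Q1 + be *: Q2; set U2 := ga *: Q1 + de *: Q2.
move=> [dety sq1 [sq q20] copq critQ].
have sT1 : (size T1 <= n.+1)%N by apply: size_pencil.
have sT2 : (size T2 <= n.+1)%N by apply: size_pencil.
have sU1 : (size U1 <= m.+1)%N by apply: size_pencil.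
have sU2 : (size U2 <= m.+1)%N by apply: size_pencil.
(* A common change of target coordinate multiplies the curve by its determinant. *)
have curveE : ((al * de - be * ga)%:P%:P * V) * W = U2 *: T1 ^:P - U1 *: T2 ^:P.
  have lin (u v : K) (p q : {poly K}) :
      (u *: p + v *: q) ^:P = u%:P%:P * p ^:P + v%:P%:P * q ^:P.
    transitivity ((u *: p) ^:P + (v *: q) ^:P); first exact: raddfD.
    by rewrite !(map_polyZ polyC) -!mul_polyC.
  rewrite -mulrA -VW /hcurve -!mul_polyC /T1 /T2 /U1 /U2 !lin -!mul_polyC.
  rewrite !(polyCD, polyCB, polyCM, polyCN); ring.
have Vn' : ((al * de - be * ga)%:P%:P * V) \isn't a GRing.unit.
  by rewrite unitrM negb_and Vn orbT.
have [F0 [G0 [sF sG FG]]] := curve_transfer sT1 sT2 sU1 sU2 sp1 sp p20 sq1 sq q20 copp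
  Vn' Wn curveE.
(* If both fibres over [r] were degenerate, [r] would be a common critical value; but [c1] is
   [r = 0] and [c2] is no finite [r]. *)
have nodouble r : r != 0 ->
    separable_poly (homp s t n T1 - r *: homp s t n T2) ||
    separable_poly (homp s' t' m U1 - r *: homp s' t' m U2).
  move=> r0; rewrite -[_ || _]negbK negb_or; apply/negP => /andP[/critP Pr /critQ Qr].
  have nz : (r * de - be != 0) || (al - r * ga != 0).
    apply: contraTT det; rewrite negb_or !negbK !subr_eq0 => /andP[/eqP<- /eqP->].
    by apply/eqP; ring.
  have det' : al * de - be * ga = u1 * v2 - u2 * v1 by rewrite /al /be /ga /de; ring.
  case: (only _ (conj Pr Qr)).
    rewrite c1E => /(hpoint_cross nz uv1)/eqP; rewrite -subr_eq0 => /eqP H.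
    case/negP: (mulf_neq0 r0 det); apply/eqP; rewrite det' -[RHS]H.
    by rewrite /al /be /ga /de; ring.
  rewrite c2E => /(hpoint_cross nz uv2)/eqP; rewrite -subr_eq0 => /eqP H.
  case/negP: det; apply/eqP; rewrite det' -[RHS]H.
  by rewrite /al /be /ga /de; ring.
have [D [R [S [D1 RE SE]]]] := reducible_common_power p20 sp q20 sq copp copq
  nodouble sF sG FG.
have D0 : (0 < D)%N by apply: ltnW.
have [e [A [B [nE sA sB p1E p2E]]]] :=
  common_power D0 p20 sp1 (ltnW (leq_trans sp (eq_leq sp1))) copp RE.
have [f [C [G [mE sC sG' q1E q2E]]]] :=
  common_power D0 q20 sq1 (ltnW (leq_trans sq (eq_leq sq1))) copq SE.
have [R' R'E] := pullback detx D0 nE sA sB sT1 sT2 p1E p2E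
  (hval_target_neq0 P2_neq0 coprimeP det) (target_nonzero P2_neq0 coprimeP det n0).
have [S' S'E] := pullback dety D0 mE sC sG' sU1 sU2 q1E q2E
  (hval_target_neq0 Q2_neq0 coprimeQ det) (target_nonzero Q2_neq0 coprimeQ det m0).
exists R', S', (mobius de (- be) (- ga) al), D; split=> //.
- by apply: mobius_is_mobius; rewrite mulrNN [de * al]mulrC.
- by move=> x; rewrite (ratmap_target P2_neq0 coprimeP det) R'E.
- by move=> x; rewrite (ratmap_target Q2_neq0 coprimeQ det) S'E.
Qed.

End Forward.

(** * Compositions with a power map *)

Section Converse.
Variable K : numClosedFieldType.

Lemma horner_eq0 (p : {poly K}) : (forall z, p.[z] = 0) -> p = 0.
Proof.
move=> p0; have : size (p + 1) == 1%N.
  rewrite -[_ == _]negbK; apply/negP => /closed_rootP[z].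
  by rewrite rootE hornerD p0 add0r hornerC oner_eq0.
move/eqP => s1; have := size1_polyC (eq_leq s1) => E.
have [k pC] : exists k, p = k%:P by exists ((p + 1)`_0 - 1); rewrite polyCB -E addrK.
by have := p0 0; rewrite pC hornerC => ->; rewrite polyC0.
Qed.

Definition rdeg (p q : {poly K}) := (maxn (size p) (size q)).-1.

(** Were the top coefficient [A_e B'(y) - B_e A'(y)] zero, [A' / B'] would be constant. In the
    proof, a second independent combination of [A'] and [B'] has a zero in positive degree, and
    there both combinations would vanish. *)
Lemma size_biform (A B A' B' : {poly K}) :
  B != 0 -> coprimep A B -> B' != 0 -> coprimep A' B' -> (0 < rdeg A' B')%N ->
  size (A ^:P * B'%:P - B ^:P * A'%:P) = (rdeg A B).+1.
Proof.
move=> B0 cop B'0 cop' d'0; set e := rdeg A B.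
have s2 : (size (A ^:P * B'%:P - B ^:P * A'%:P)%R <= e.+1)%N.
  have le : (size A <= e.+1)%N /\ (size B <= e.+1)%N.
    rewrite /e /rdeg prednK; last by rewrite leq_max !size_poly_gt0 B0 orbT.
    by rewrite leq_maxl leq_maxr.
  rewrite (leq_trans (size_polyD _ _)) // size_polyN geq_max.
  rewrite [A ^:P * _]mulrC [B ^:P * _]mulrC !mul_polyC.
  by rewrite !(leq_trans (size_scale_leq _ _)) // size_map_polyC; case: le.
apply/anti_leq; rewrite s2 /= ltnNge; apply/negP => /leq_sizeP/(_ _ (leqnn e)).
rewrite coefB !coefMC !coef_map => E.
have := hval_neq0 B0 cop None; rewrite /= -/e => nz.
have [u [v det]] : exists u v : K, - B`_e * v - A`_e * u != 0.
  case/orP: nz => nz; first by exists (-1), 0; rewrite mulr0 sub0r mulrN1 opprK.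
  by exists 0, 1; rewrite mulr1 mulr0 subr0 oppr_eq0.
have [x x0] := hval_has_zero d'0 (size_pencil d'0 u v).
have := hval_target_neq0 B'0 cop' det x; rewrite x0 eqxx orbF.
have -> : - B`_e *: A' + A`_e *: B' = 0.
  by rewrite -E -!mul_polyC polyCN; ring.
have -> : hval (maxn (size A') (size B')).-1 0 x = 0.
  by clear; case: x => [z|]; [exact: horner0 | exact: coef0].
by rewrite eqxx.
Qed.

Section OneMap.
Variables (P1 P2 : {poly K}) (a b c d : K) (D : nat) (R : ratfun K).
Hypotheses (P2_neq0 : P2 != 0) (coprimeP : coprimep P1 P2).
Hypotheses (det_neq0 : a * d - b * c != 0) (D_gt0 : (0 < D)%N).
Hypothesis PE : forall x,
  ratmap (P1%:F / P2%:F) x = mobius a b c d (zpow D (ratmap R x)).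
Notation A := (ratnum R).
Notation B := (ratden R).
Notation X1 := (a *: A ^+ D + b *: B ^+ D).
Notation X2 := (c *: A ^+ D + d *: B ^+ D).

(** Both pairs are coprime and define the same map; the values at finite points already give the
    polynomial identity that makes them proportional. *)
Lemma composite_num_den : exists2 k, k != 0 & P1 = k *: X1 /\ P2 = k *: X2.
Proof.
have B0 := ratden_neq0 R; have AB := coprimep_ratnum_ratden R.
have nz z : (A.[z] ^+ D != 0) || (B.[z] ^+ D != 0).
  by rewrite !expf_eq0 D_gt0 /=; exact: (hval_neq0 B0 AB (Some z)).
have E : P1 * X2 = X1 * P2.
  apply/eqP; rewrite -subr_eq0; apply/eqP/horner_eq0 => z; rewrite !hornerE.
  have := PE (Some z); rewrite ratmapE // [R in ratmap R _](ratfunE R) ratmapE //.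
  rewrite zpow_hpoint // mobius_hpoint // => /hpoint_cross -> //.
  - by rewrite subrr.
  - exact: (hval_neq0 P2_neq0 coprimeP (Some z)).
  - exact: det_mul_neq0.
have cX : coprimep X1 X2.
  apply: Pdiv.ClosedField.root_coprimep => z; rewrite rootE !hornerE => X1z.
  by have := det_mul_neq0 det_neq0 (nz z); rewrite X1z.
have d1 : X2 %| P2.
  by rewrite -(@Gauss_dvdpr _ _ X1) -?E ?dvdp_mull // coprimep_sym.
have d2 : P2 %| X2.
  by rewrite -(@Gauss_dvdpr _ _ P1) ?E ?dvdp_mull // coprimep_sym.
have /eqpf_eq[k k0 kE] : P2 %= X2 by rewrite /eqp d2 d1.
have X20 : X2 != 0 by apply: contraNneq P2_neq0 => X20; rewrite kE X20 scaler0.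
exists k => //; split=> //; apply: (mulIf X20).
by rewrite E {1}kE -scalerAl -scalerAr.
Qed.

Lemma composite_degree : (0 < rdeg P1 P2)%N -> (0 < rdeg A B)%N.
Proof.
have [k k0 [-> ->]] := composite_num_den.
rewrite /rdeg !size_scale // !lt0n; apply: contraNneq => e0.
have sAB (p : {poly K}) : p = A \/ p = B -> (size (p ^+ D) <= 1)%N.
  move=> pAB; have : (size p <= 1)%N.
    rewrite -subn_eq0 subn1 -leqn0 -e0 -!subn1 leq_sub2r // leq_max.
    by case: pAB => ->; rewrite leqnn ?orbT.
  by move=> s1; rewrite -[1%N]/((0 * D).+1) size_exp_top.
rewrite -leqn0 -subn1 leq_subLR addn0 geq_max.
by rewrite !(leq_trans (size_polyD _ _)) // geq_max !(leq_trans (size_scale_leq _ _)) // ?sAB; auto.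
Qed.

End OneMap.

Lemma rdegX (p q : {poly K}) D : rdeg (p ^+ D) (q ^+ D) = (rdeg p q * D)%N.
Proof. by rewrite /rdeg -!subn1 !subn_maxl !subn1 !size_exp maxnMl. Qed.

(** The curve is a constant times [U ^ D - V ^ D], which [U - V] divides. By [size_biform] the
    degree in [x] is multiplied by [D > 1], so the cofactor is not a unit. *)
Lemma composite_reducible (P1 P2 Q1 Q2 : {poly K}) (a b c d : K) D (R S : ratfun K) :
  P2 != 0 -> coprimep P1 P2 -> Q2 != 0 -> coprimep Q1 Q2 ->
  (0 < rdeg P1 P2)%N -> (0 < rdeg Q1 Q2)%N ->
  a * d - b * c != 0 -> (1 < D)%N ->
  (forall x, ratmap (P1%:F / P2%:F) x = mobius a b c d (zpow D (ratmap R x))) ->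
  (forall x, ratmap (Q1%:F / Q2%:F) x = mobius a b c d (zpow D (ratmap S x))) ->
  reducible (hcurve P1 P2 Q1 Q2).
Proof.
move=> P20 cP Q20 cQ nP nQ det D1 PE QE; have D0 := ltnW D1.
have e0 := composite_degree P20 cP det D0 PE nP.
have f0 := composite_degree Q20 cQ det D0 QE nQ.
have [k k0 [P1E P2E]] := composite_num_den P20 cP det D0 PE.
have [l l0 [Q1E Q2E]] := composite_num_den Q20 cQ det D0 QE.
move: e0 f0 P1E P2E Q1E Q2E (ratden_neq0 R) (coprimep_ratnum_ratden R)
  (ratden_neq0 S) (coprimep_ratnum_ratden S).
move: (ratnum R) (ratden R) (ratnum S) (ratden S) => A B A' B'.
move=> e0 f0 P1E P2E Q1E Q2E B0 AB B'0 AB'.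
pose U := A ^:P * B'%:P; pose V := B ^:P * A'%:P.
have hE : hcurve P1 P2 Q1 Q2 = (k * l * (a * d - b * c))%:P%:P * (U ^+ D - V ^+ D).
  have lin (r u v : K) (p q : {poly K}) :
      (r *: (u *: p + v *: q)) ^:P = r%:P%:P * (u%:P%:P * p ^:P + v%:P%:P * q ^:P).
    rewrite (map_polyZ polyC) -mul_polyC; congr (_ * _).
    transitivity ((u *: p) ^:P + (v *: q) ^:P); first exact: raddfD.
    by rewrite !(map_polyZ polyC) -!mul_polyC.
  have pX (p : {poly K}) : (p ^+ D) ^:P = (p ^:P) ^+ D by exact: rmorphXn.
  rewrite /hcurve P1E P2E Q1E Q2E !lin -!mul_polyC !pX /U /V !exprMn.
  rewrite !(polyCD, polyCB, polyCM, polyCN) -!polyC_exp.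
  by ring.
have kl0 : k * l * (a * d - b * c) != 0 by rewrite !mulf_neq0.
have sUV : size (U - V) = (rdeg A B).+1 by apply: size_biform.
have pXD (p : {poly K}) : (p ^+ D) ^:P = (p ^:P) ^+ D by exact: rmorphXn.
have sUVD : size (U ^+ D - V ^+ D) = (rdeg A B * D).+1.
  have -> : U ^+ D - V ^+ D = (A ^+ D) ^:P * (B' ^+ D)%:P - (B ^+ D) ^:P * (A' ^+ D)%:P.
    by rewrite !pXD !polyC_exp /U /V !exprMn.
  rewrite size_biform ?rdegX ?expf_neq0 ?muln_gt0 ?f0 //.
  - by rewrite coprimep_expl // coprimep_expr.
  - by rewrite coprimep_expl // coprimep_expr.
rewrite hE subrXX; set W := \sum_(i < D) _.
have UV0 : U - V != 0 by rewrite -size_poly_gt0 sUV.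
have sW : (1 < size W)%N.
  move: sUVD; rewrite subrXX -/W; have [->|W0] := eqVneq W 0.
    by rewrite mulr0 size_poly0.
  rewrite size_mul // sUV addSn /= => H; rewrite -(ltn_add2l (rdeg A B)) H addn1 ltnS.
  by rewrite -[X in (X < _)%N]muln1 ltn_pmul2l.
exists (U - V), ((k * l * (a * d - b * c))%:P%:P * W); split.
- by rewrite poly_unitE sUV negb_and eqSS -lt0n e0.
- by rewrite unitrM negb_and orbC poly_unitE negb_and gtn_eqF.
by rewrite mulrCA.
Qed.

End Converse.

Theorem proposition3p3 (T : realType) (P Q : ratfun T[i])
    (P1 P2 Q1 Q2 : {poly T[i]})
    (P2_neq0 : P2 != 0) (coprimeP : coprimep P1 P2) (PE : P = P1%:F / P2%:F)
    (Q2_neq0 : Q2 != 0) (coprimeQ : coprimep Q1 Q2) (QE : Q = Q1%:F / Q2%:F)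
    (two_common : critical_values P `&` critical_values Q #= `I_2) :
  reducible (hcurve P1 P2 Q1 Q2) <->
  exists (R S : ratfun T[i]) (mu : projline T[i] -> projline T[i]) (d : nat),
    [/\ is_mobius mu, (1 < d)%N,
        ratmap P =1 mu \o zpow d \o ratmap R &
        ratmap Q =1 mu \o zpow d \o ratmap S].
Proof.
move: two_common; rewrite PE QE => two_common.
split; first exact: reducible_factor.
move=> [R [S [mu [D [[a [b [c [d [det muE]]]]] D1 RE SE]]]]].
(* A common critical value is needed here only to know that [P] and [Q] are not constant. *)
have [x [_ [[Px Qx] _ _ _]]] := card_eq2 two_common.
apply: (composite_reducible P2_neq0 coprimeP Q2_neq0 coprimeQ _ _ det D1).
- by have := critical_ratdeg Px; rewrite ratdegE.
- by have := critical_ratdeg Qx; rewrite ratdegE.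
- by move=> y; exact: (etrans (RE y) (muE (zpow D (ratmap R y)))).
- by move=> y; exact: (etrans (SE y) (muE (zpow D (ratmap S y)))).
Qed.
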